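(* For every squarefree positive integer $b$ and every positive integer $a$ with $a/b\ge B_{N_b}/6$, the rational $a/b$ is a finite sum of distinct unit fractions each of whose denominators is a product of two distinct primes. In particular, for every positive integer $a$, the number $a/2$ is such a sum.
   Context: $p_n$ denotes the $n$-th prime ($p_1=2$, $p_2=3$, ...). For $N\ge 1$, \[ B_N=\sum_{1\le i<j\le N}\frac{1}{p_ip_j} \] (so $B_1=0$). For squarefree $b>1$, $N_b$ is the index of the largest prime factor of $b$, i.e. $p_{N_b}$ is the largest prime dividing $b$. For $b=1$ use the convention $N_1=0$, $B_0=0$. *)

(* Defs.v *)
From mathcomp Require Import all_boot all_order all_algebra.

Set Implicit Arguments.
Unset Strict Implicit.
Unset Printing Implicit Defensive.

Import Order.TTheory GRing.Theory Num.Theory.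

Lemma ex_prime_above (m : nat) : exists p, (m < p) && prime p.
Proof. by case: (prime_above m) => p mp pp; exists p; rewrite mp. Qed.

Definition next_prime (m : nat) : nat := ex_minn (ex_prime_above m).

(* 1-based: nth_prime 1 = 2, nth_prime 2 = 3, and so on; the value
   nth_prime 0 = 0 is a junk value, not a prime. *)
Definition nth_prime (n : nat) : nat := iter n next_prime 0.

Definition squarefree (b : nat) : Prop :=
  forall d : nat, d ^ 2 %| b -> d = 1.

(* The index N_b of the largest prime factor of b, with N_1 = 0. The search
   range suffices because n <= nth_prime n; see nth_prime_lpf_index. *)
Definition lpf_index (b : nat) : nat :=
  if b == 1 then 0
  else index (max_pdiv b) [seq nth_prime n | n <- iota 0 (max_pdiv b).+1].

Definition two_prime_product (m : nat) : Prop :=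
  exists p q : nat, [/\ prime p, prime q, p != q & m = p * q].

Local Open Scope ring_scope.

Definition B (N : nat) : rat :=
  \sum_(1 <= i < N.+1) \sum_(i.+1 <= j < N.+1)
    1 / ((nth_prime i)%:R * (nth_prime j)%:R).

Definition is_sum_of_two_prime_unit_fractions (x : rat) : Prop :=
  exists s : seq nat,
    [/\ uniq s,
        (forall m : nat, m \in s -> two_prime_product m) &
        x = \sum_(m <- s) 1 / m%:R].

Local Close Scope ring_scope.

Lemma next_primeP m :
  [/\ m < next_prime m, prime (next_prime m) &
      forall p, m < p -> prime p -> next_prime m <= p].
Proof.
rewrite /next_prime; case: ex_minnP => p /andP[mp pp] pmin.
by split=> // q mq pq; apply: pmin; rewrite mq.
Qed.

Lemma nth_primeS n : nth_prime n.+1 = next_prime (nth_prime n).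
Proof. by []. Qed.

Lemma prime_nth_prime n : 0 < n -> prime (nth_prime n).
Proof. by case: n => // n _; rewrite nth_primeS; case: (next_primeP (nth_prime n)). Qed.

Lemma leq_nth_prime n : n <= nth_prime n.
Proof.
elim: n => // n IHn; rewrite nth_primeS.
by case: (next_primeP (nth_prime n)) => lt_n _ _; apply: leq_ltn_trans lt_n.
Qed.

Lemma nth_prime_surj p : prime p -> exists n, nth_prime n = p.
Proof.
move=> pp.
have below k : (exists n, nth_prime n = p) \/ nth_prime k < p.
  elim: k => [|k [ex_n | lt_k]]; [by right; exact: prime_gt0 | by left |].
  case: (next_primeP (nth_prime k)) => _ _ /(_ p lt_k pp).
  rewrite -nth_primeS leq_eqVlt => /orP[/eqP <- | ]; last by right.
  by left; exists k.+1.
by case: (below p) => //; rewrite ltnNge leq_nth_prime.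
Qed.

Lemma nth_prime_lpf_index b :
  1 < b -> 0 < lpf_index b /\ nth_prime (lpf_index b) = max_pdiv b.
Proof.
move=> b_gt1; have pq := max_pdiv_prime b_gt1.
have [n def_q] := nth_prime_surj pq.
rewrite /lpf_index (gtn_eqF b_gt1); set q := max_pdiv b in pq def_q *.
set s := [seq _ | _ <- _].
have q_s : q \in s.
  apply/mapP; exists n; last by [].
  by rewrite mem_iota add0n ltnS -def_q leq_nth_prime.
have def_i : nth_prime (index q s) = q.
  have lt_i : index q s < size s by rewrite index_mem.
  have := nth_index 0 q_s; rewrite {1}/s (nth_map 0) ?nth_iota //.
    by move: lt_i; rewrite size_map size_iota.
  by move: lt_i; rewrite size_map.
split=> //; rewrite lt0n; apply/eqP => i0.
by move: def_i pq; rewrite i0 /= => <-.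
Qed.

(* Main.v *)
(* Write P for the product of the first N primes and A, B for the sums of 1/p
   and 1/(p q) over them. If all multiples of 1/P between a and B - a are sums of
   distinct 1/(p q), then one more prime p keeps this true with a + C/p in place of
   a, provided every residue modulo p is a sum of inverses of distinct smaller
   primes whose real reciprocals add up to at most C: subtract such a sum divided
   by p to make the numerator divisible by p, and treat the upper half of the range
   by complementation. With a = B/6 the new bound is again B/6 as soon as C <= A/6.

   For p > 1300 such residue sums come from additive combinatorics: the inverses of
   k odd primes together with their opposites are 2k distinct residues, so by
   Cauchy-Davenport some inverse spills a good part of any set of at most p/2
   subset sums out of itself; hence about 2 sqrt p primes give more than p/2 subset
   sums, and two disjoint such families give all residues. Chebyshev's bound
   provides enough primes that are large compared with sqrt p. For p <= 1300 a
   table of minimal costs is computed.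

   The induction starts at N = 9 with a = 12/83, obtained by a computation that
   follows the few unrepresented multiples from one level to the next; the values
   below 12/83 whose denominator involves only the first 8 primes are checked one
   by one. *)
Require Import Defs.
From Stdlib Require Import ZArith MSetPositive.
From mathcomp Require Import all_boot all_order all_algebra ssrZ zify ring lra.

Set Implicit Arguments.
Unset Strict Implicit.
Unset Printing Implicit Defensive.

Import Order.TTheory GRing.Theory Num.Theory.

Local Open Scope ring_scope.

(** * Subset sums modulo a prime *)

Definition sumset (V : finZmodType) (X Y : {set V}) : {set V} :=
  [set x + y | x in X, y in Y].

(** [X] meets the set of all [z - y] with [y] in [Y], because the two sizes add up to more than the
    order of the group. *)
Lemma sumset_pigeonhole (V : finZmodType) (X Y : {set V}) (z : V) :
  (#|V| < #|X| + #|Y|)%N -> exists x y, [/\ x \in X, y \in Y & x + y = z].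
Proof.
move=> big; have inj : injective (fun y : V => z - y).
  by move=> y y' /addrI/oppr_inj.
have : X :&: [set z - y | y in Y] != set0.
  apply: contraTneq big => XY0; rewrite -leqNgt -(card_imset (mem Y) inj).
  by rewrite -cardsUI XY0 cards0 addn0 max_card.
case/set0Pn=> x /setIP[xX /imsetP[y yY xE]]; exists x, y; split=> //.
by rewrite xE subrK.
Qed.

Lemma growth_arith (s l t m s' : nat) : (0 < l)%N -> (0 < s)%N ->
    (t * l <= s + l.-1)%N -> (s <= t * l)%N -> (s < (t * m).*2)%N -> (s + m <= s')%N ->
  if (s <= l)%N then (s * 3 < s'.*2)%N else (s * 4 + l < s' * 4)%N.
Proof.
move=> l0 s0 tl st am ss'; case: (leqP s l) => [sl|ls].
  have t1 : t = 1%N.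
    have : (t * l < 2 * l)%N by lia.
    by rewrite ltn_pmul2r //; case: t tl st am => [|[|t]] //; lia.
  by move: am; rewrite t1; lia.
have : (l * s < 4 * m * s)%N.
  have h1 : (l * s < l * (t * m).*2)%N by rewrite ltn_pmul2l.
  apply: leq_trans h1 _; have : (t * l * m <= s.*2 * m)%N by rewrite leq_mul2r; lia.
  by rewrite -!muln2; lia.
by rewrite ltn_pmul2r //; lia.
Qed.

Section PrimeField.
Variable p : nat.
Hypothesis p_pr : prime p.
Local Notation F := 'F_p.
Implicit Types (A S X Y : {set F}) (x y a b : F).

Lemma translate_stable_full A a b : b != 0 -> a \in A ->
  (forall x, x \in A -> x + b \in A) -> A = setT.
Proof.
move=> b0 aA Ab; apply/setP=> x; rewrite inE.
have An n : a + b *+ n \in A.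
  by elim: n => [|n IHn]; rewrite ?mulr0n ?addr0 // mulrSr addrA Ab.
suff -> : x = a + b *+ ((x - a) / b : F)%R by apply: An.
by rewrite -mulr_natr natr_Zp mulrC divfK // addrC subrK.
Qed.

(* The e-transform: replacing (A, B) by (A :|: (B + e), B :&: (A - e)) keeps
   #|A| + #|B|, does not enlarge A + B, and can be chosen to shrink B. *)
Lemma Cauchy_Davenport X Y : X != set0 -> Y != set0 ->
  (minn p (#|X| + #|Y|).-1 <= #|sumset X Y|)%N.
Proof.
move: {2}(#|Y|)%N (leqnn #|Y|) => n; elim: n X Y => [|n IHn] X Y.
  by rewrite leqn0 cards_eq0 => ->.
move=> Yn /set0Pn[x0 x0X] Y0.
have [y0 y0Y] := set0Pn _ Y0.
have [XT | XnT] := eqVneq X setT.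
  apply: leq_trans (geq_minl _ _) _; rewrite -[X in (X <= _)%N](card_Fp p_pr).
  rewrite -cardsT -XT -(card_imset (mem X) (addIr y0)) subset_leq_card //.
  apply/subsetP=> _ /imsetP[x xX ->]; apply/imset2P; exists x y0 => //.
have [/eqP Y1 | /eqP Yn1] := altP (#|Y| =P 1%N).
  have /cards1P[y Yy] := Y1; rewrite (eqP Y1) addn1 /=.
  apply: leq_trans (geq_minr _ _) _.
  rewrite -(card_imset (mem X) (addIr y)) subset_leq_card //.
  apply/subsetP=> _ /imsetP[x xX ->]; apply/imset2P; exists x y => //.
  by rewrite Yy set11.
have [y1 y1Y y10] : exists2 y, y \in Y & y != y0.
  apply/exists_inP; apply: contra_notT Yn1 => /exists_inPn all0.
  suff -> : Y = [set y0] by rewrite cards1.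
  apply/setP=> y; rewrite inE; apply/idP/eqP=> [/all0|->//].
  by rewrite negbK => /eqP.
(* With [e = x - y0] the new second set keeps [y0], since [y0 + e = x] lies in [X], and loses [y1],
   since [y1 + e] does not. *)
have [x xX xbX] : exists2 x, x \in X & x + (y1 - y0) \notin X.
  apply/exists_inP; apply: contraNT XnT => /exists_inPn allX.
  apply/eqP; apply: (@translate_stable_full _ x0 (y1 - y0)) => //.
    by rewrite subr_eq0.
  by move=> x /allX; rewrite negbK.
pose e := x - y0.
pose Ye := [set y + e | y in Y].
pose X' := X :|: Ye; pose Y' := [set z - e | z in X :&: Ye].
have injD (c : F) : injective (fun z : F => z + c) by exact: addIr.
have cY' : #|Y'| = #|X :&: Ye| by rewrite card_imset //; exact: injD.
have cYe : #|Ye| = #|Y| by rewrite card_imset //; exact: injD.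
have sum : (#|X'| + #|Y'| = #|X| + #|Y|)%N by rewrite cY' -cYe cardsUI.
have sub : sumset X' Y' \subset sumset X Y.
  apply/subsetP=> _ /imset2P[u v uX' /imsetP[z /setIP[zX /imsetP[y yY zE]] ->] ->].
  case/setUP: uX' => [uX | /imsetP[y' y'Y ->]].
    by apply/imset2P; exists u y => //; rewrite zE addrK.
  by apply/imset2P; exists z y' => //; rewrite addrAC -addrA subrK addrC.
have Y'0 : Y' != set0.
  apply/set0Pn; exists y0; apply/imsetP; exists x; last by rewrite /e subKr.
  by rewrite inE xX /=; apply/imsetP; exists y0; rewrite // /e addrC subrK.
have Y'lt : (#|Y'| < #|Y|)%N.
  rewrite cY' -cYe proper_card //; apply/properP; split; first exact: subsetIr.
  exists (y1 + e); first by apply/imsetP; exists y1.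
  by rewrite inE negb_and /e addrCA xbX.
apply: leq_trans (subset_leq_card sub); rewrite -sum; apply: IHn => //.
  by rewrite -ltnS (leq_trans Y'lt).
by apply/set0Pn; exists x0; rewrite inE x0X.
Qed.

(** * Translates of a set and their spill *)

Definition shiftset S x : {set F} := [set u + x | u in S].

(** Adjoining a new element [x] to a set whose subset sums form [S] yields at least this many
    further subset sums. As a function of [x] it is even and subadditive. *)
Definition spill S x : nat := #|shiftset S x :\: S|.

Lemma card_shiftset S x : #|shiftset S x| = #|S|.
Proof. by rewrite card_imset //; apply: addIr. Qed.

Lemma shiftsetD S x y : shiftset (shiftset S x) y = shiftset S (x + y).
Proof.
by rewrite /shiftset -imset_comp; apply: eq_imset => u /=; rewrite addrA.
Qed.

Lemma shiftset0 S : shiftset S 0 = S.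
Proof. by rewrite /shiftset (eq_imset _ (@addr0 _)) imset_id. Qed.

Lemma spill0 S : spill S 0 = 0%N.
Proof. by rewrite /spill shiftset0 setDv cards0. Qed.

Lemma spillE S x : (spill S x + #|shiftset S x :&: S| = #|S|)%N.
Proof. by rewrite addnC cardsID card_shiftset. Qed.

Lemma spillN S x : spill S (- x) = spill S x.
Proof.
have: (spill S (- x) + #|shiftset S (- x) :&: S| =
       spill S x + #|shiftset S x :&: S|)%N by rewrite !spillE.
suff -> : #|shiftset S (- x) :&: S| = #|shiftset S x :&: S| by move/addIn.
rewrite -(card_shiftset (_ :&: S) x); congr #|pred_of_set _|.
apply/setP=> u; apply/imsetP/setIP=> [[v /setIP[/imsetP[w wS ->] vS] ->]|].
  by rewrite subrK wS; split=> //; apply/imsetP; exists (w - x) => //; rewrite subrK.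
case=> /imsetP[w wS ->] wxS; exists w => //; rewrite inE wS andbT.
by apply/imsetP; exists (w + x); rewrite // addrK.
Qed.

(** An element of S + x + y outside [S] is [v + y] with [v] in S + x. If [v] is in [S], the element
    is spilled by [y]; otherwise [v] is spilled by [x]. *)
Lemma spillD S x y : (spill S (x + y)%R <= spill S x + spill S y)%N.
Proof.
rewrite /spill -shiftsetD -(card_shiftset (shiftset S x :\: S) y).
apply: leq_trans (leq_card_setU _ _); apply: subset_leq_card.
apply/subsetP=> u /setDP[/imsetP[v vSx ->] uS].
have [vS | vS] := boolP (v \in S).
  by rewrite inE; apply/orP; right; rewrite inE uS; apply/imsetP; exists v.
by rewrite inE; apply/orP; left; apply/imsetP; exists v; rewrite // inE vS.
Qed.

(** Double counting: an ordered pair of distinct elements of [S] has only one difference, so the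
    intersections of [S] with its translates by [X] have total size at most |S| (|S| - 1). *)
Lemma sum_spill S X : 0 \notin X ->
  (#|X| * #|S| <= \sum_(x in X) spill S x + #|S| * #|S|.-1)%N.
Proof.
move=> X0; pose U := [set uv in setX S S | uv.1 != uv.2].
have cU : (#|U| <= #|S| * #|S|.-1)%N.
  rewrite -sum_nat_const -[X in (X <= _)%N]sum1_card.
  rewrite (eq_bigl (fun uv => (uv.1 \in S) && ((uv.2 \in S) && (uv.1 != uv.2)))).
    rewrite -(pair_big_dep (mem S) (fun u v => (v \in S) && (u != v)) (fun _ _ => 1%N)) /=.
    apply: leq_sum => u uS; rewrite sum1dep_card.
    rewrite (cardsD1 u S) [u \in S]uS add1n /= subset_leq_card //.
    by apply/subsetP=> v; rewrite !inE andbC eq_sym.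
  by case=> u v; rewrite !inE /= andbA.
rewrite -sum_nat_const.
apply: (@leq_trans (\sum_(x in X) (spill S x + #|shiftset S x :&: S|))).
  by apply: leq_sum => x _; rewrite spillE.
rewrite big_split /= leq_add2l; apply: leq_trans cU.
have -> : (\sum_(x in X) #|shiftset S x :&: S| =
           \sum_(x in X) #|[set uv in U | (uv.2 - uv.1)%R == x]|)%N.
  apply: eq_bigr => x xX.
  have inj : injective (fun u : F => (u - x, u)) by move=> u v [].
  rewrite -(card_imset _ inj); congr #|pred_of_set _|; apply/setP=> [[u v]].
  apply/imsetP/idP=> [[w /setIP[/imsetP[z zS ->] wS] [-> ->]]|].
    rewrite !inE /= addrK zS wS [z + x]addrC addrK eqxx andbT /=.
    by apply: contraNneq X0 => zE; rewrite -(addrK z x) -zE subrr in xX.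
  rewrite !inE /= => /andP[/andP[/andP[uS vS] _] /eqP xE].
  exists v; last by rewrite -xE subKr.
  rewrite inE vS andbT; apply/imsetP; exists u => //.
  by rewrite -xE addrC subrK.
have -> : (\sum_(x in X) #|[set uv in U | (uv.2 - uv.1)%R == x]| =
           \sum_(x in X) \sum_(uv in U | (uv.2 - uv.1)%R == x) 1)%N.
  by apply: eq_bigr => x _; rewrite -sum1_card; apply: eq_bigl => uv; rewrite !inE.
rewrite (exchange_big_dep (mem U)) /=; last by move=> x uv _ /andP[].
rewrite -sum1_card; apply: leq_sum => uv uvU.
rewrite sum1dep_card.
have sub1 : [set x in X | (uv \in U) && ((uv.2 - uv.1)%R == x)] \subset [set (uv.2 - uv.1)%R].
  by apply/subsetP=> x; rewrite !inE => /and3P[_ _ /eqP ->].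
by apply: leq_trans (subset_leq_card sub1) _; rewrite cards1.
Qed.

Definition symm A : {set F} := 0 |: (A :|: [set - a | a in A]).

Lemma card_symm A : 0 \notin A -> (forall a, a \in A -> - a \notin A) ->
  #|symm A| = (#|A|.*2).+1.
Proof.
move=> A0 AN; rewrite cardsU1 inE negb_or A0 /=.
have -> : 0 \notin [set - a | a in A].
  by apply: contra A0 => /imsetP[a aA /eqP]; rewrite eq_sym oppr_eq0 => /eqP <-.
rewrite cardsU (card_imset (mem A) oppr_inj) /=.
rewrite (_ : A :&: _ = set0) ?cards0 ?subn0 ?addnn //.
apply/setP=> a; rewrite !inE; apply/andP=> [[aA /imsetP[b bA aE]]].
by move: (AN _ bA); rewrite -aE aA.
Qed.

Fixpoint multisum X t := if t is t'.+1 then sumset X (multisum X t') else [set 0].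

(** By Cauchy-Davenport each further summand adds [#|X|.-1] elements until [p] is reached. *)
Lemma card_multisum X t : 0 \in X -> (minn p (t * #|X|.-1).+1 <= #|multisum X t|)%N.
Proof.
move=> X0; elim: t => [|t IHt] /=; first by rewrite mul0n cards1 geq_minr.
have X1 : X != set0 by apply/set0Pn; exists 0.
have M1 : multisum X t != set0.
  rewrite -card_gt0; apply: leq_trans IHt.
  by rewrite leq_min prime_gt0.
have := Cauchy_Davenport X1 M1; move: IHt.
have : (0 < #|X|)%N by rewrite card_gt0.
move: #|X| #|multisum X t| #|sumset X (multisum X t)| => a b c.
by rewrite mulSn; move: (t * a.-1)%N => ta; lia.
Qed.

Lemma spill_multisum S A m t x : (forall a, a \in A -> (spill S a <= m)%N) ->
  x \in multisum (symm A) t -> (spill S x <= t * m)%N.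
Proof.
move=> Am; elim: t x => [|t IHt] x /=; first by rewrite inE => /eqP->; rewrite spill0.
case/imset2P=> a y aA yM ->; apply: leq_trans (spillD _ _ _) _.
rewrite mulSn leq_add ?IHt //; move: aA; rewrite !inE.
by case/or3P=> [/eqP->|/Am//|/imsetP[b /Am bm ->]]; rewrite ?spill0 ?spillN.
Qed.

(** Let [m] be the largest spill over [A]. Sums of [t] elements of [symm A] spill at most t m, and
    there are at least 2 |S| nonzero ones by [card_multisum]. Over 2 |S| of these, [sum_spill] gives
    2 |S| <= 2 t m + |S| - 1. *)
Lemma exists_spill S A t : 0 \notin A -> (forall a, a \in A -> - a \notin A) ->
  A != set0 -> S != set0 -> (#|S|.*2 < p)%N -> (#|S| <= t * #|A|)%N ->
  exists2 a, a \in A & (#|S| < (t * spill S a).*2)%N.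
Proof.
move=> A0 AN /set0Pn[a0 a0A] S0 Sp St.
case: (@eq_bigmax_cond _ (mem A) (spill S)).
  by apply/card_gt0P; exists a0.
move=> a aA amax; exists a => //; set m := spill S a in amax *.
have Am b : b \in A -> (spill S b <= m)%N.
  by move=> bA; rewrite -amax; exact: leq_bigmax_cond.
set M := multisum (symm A) t.
have cM : (#|S|.*2.+1 <= #|M|)%N.
  apply: leq_trans (card_multisum t (setU11 _ _)).
  rewrite leq_min Sp card_symm //= ltnS -doubleMr leq_double //.
have : (#|S|.*2 <= #|M :\ 0%R|)%N.
  rewrite -ltnS (leq_trans cM) // (cardsD1 0 M).
  by case: (0 \in M); rewrite ?leqnn ?leqnSn.
case/card_geqP=> s [us ss sM].
pose X := [set x in s].
have cX : #|X| = #|S|.*2 by rewrite cardsE (card_uniqP us).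
have XM x : x \in X -> x \in M :\ 0 by rewrite inE; apply: sM.
have X0 : 0 \notin X by apply/negP=> /XM; rewrite !inE eqxx.
have := sum_spill S X0.
have : (\sum_(x in X) spill S x <= #|X| * (t * m))%N.
  rewrite -sum_nat_const; apply: leq_sum => x /XM /setD1P[_ xM].
  exact: spill_multisum Am xM.
rewrite cX; have : (0 < #|S|)%N by rewrite card_gt0.
move: (t * m)%N (\sum_(x in X) _)%N #|S| => tm sg k k0 h1 h2.
have {h2} : (k.*2 * k <= k.*2 * tm + k * k.-1)%N by apply: leq_trans h2 _; rewrite leq_add2r.
rewrite -!muln2 => h; nia.
Qed.

(** * Growth of the set of subset sums *)

Definition subsums A : {set F} := [set \sum_(a in T) a | T : {set F} in powerset A].

Lemma subsums_neq0 A : subsums A != set0.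
Proof.
apply/set0Pn; exists (\sum_(a in set0) a); apply/imsetP; exists set0 => //.
by rewrite powersetE sub0set.
Qed.

Lemma card_subsumsU1 A a : a \notin A ->
  (#|subsums A| + spill (subsums A) a <= #|subsums (a |: A)|)%N.
Proof.
move=> aA; set S := subsums A.
have -> : (#|S| + spill S a = #|S :|: shiftset S a|)%N.
  by rewrite -(cardsID S (S :|: _)) setUK setDUl setDv set0U.
apply: subset_leq_card; apply/subsetP=> x /setUP[]; last first.
  case/imsetP=> _ /imsetP[T TA ->] ->; apply/imsetP; exists (a |: T).
    by rewrite powersetE setUS // -powersetE.
  have aT : a \notin T.
    by apply: contra aA; move: TA; rewrite powersetE => /subsetP/(_ a).
  by rewrite (big_setU1 _ aT) [RHS]addrC.
case/imsetP=> T; rewrite powersetE => TA ->; apply/imsetP; exists T => //.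
by rewrite powersetE (subset_trans TA) // subsetUr.
Qed.

Lemma subsums_step A (T : {set F}) : 0 \notin A -> (forall a, a \in A -> - a \notin A) ->
    T \proper A -> (#|subsums T|.*2 < p)%N ->
  exists2 a, a \in A :\: T &
    let s := #|subsums T| in let s' := #|subsums (a |: T)| in let l := #|A :\: T| in
    if (s <= l)%N then (s * 3 < s'.*2)%N else (s * 4 + l < s' * 4)%N.
Proof.
move=> A0 AN TA Sp; set s := #|subsums T|; set l := #|A :\: T|.
have l0 : (0 < l)%N.
  by rewrite card_gt0 setD_eq0; case/properP: TA => _ [a aA aT]; apply/subsetPn; exists a.
have s0 : (0 < s)%N by rewrite card_gt0 subsums_neq0.
have D0 : 0 \notin A :\: T by rewrite inE negb_and A0 orbT.
have DN a : a \in A :\: T -> - a \notin A :\: T.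
  by case/setDP=> aA _; rewrite inE negb_and AN ?orbT.
pose t := ((s + l.-1) %/ l)%N.
have tl : (t * l <= s + l.-1)%N by exact: leq_trunc_div.
have st : (s <= t * l)%N.
  by have := ltn_ceil (s + l.-1) l0; rewrite mulSn -/t; lia.
clearbody t.
have := exists_spill D0 DN _ (subsums_neq0 T) Sp st.
case=> [|a aD am]; first by rewrite -card_gt0.
exists a => //; have /setDP[_ /card_subsumsU1] := aD.
rewrite -/s in am *; move: (spill _ _) am => m am ss'.
exact: (@growth_arith s l t m).
Qed.

Lemma card_subsums_doubling A i : 0 \notin A -> (forall a, a \in A -> - a \notin A) ->
    (i <= #|A|)%N ->
  exists2 T : {set F}, T \subset A /\ #|T| = i &
    [|| (p <= #|subsums T|.*2)%N, (#|A| - i <= #|subsums T|)%N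
      | (2 ^ i <= #|subsums T| ^ 2)%N].
Proof.
move=> A0 AN; elim: i => [|i IHi] iA.
  exists set0; first by rewrite sub0set cards0.
  by rewrite expn_gt0 card_gt0 subsums_neq0 !orbT.
have [T [TA cT] sT] := IHi (ltnW iA).
have cD : #|A :\: T| = (#|A| - i)%N by rewrite cardsD (setIidPr TA) cT.
have pTA : T \proper A by rewrite properEcard TA cT.
have [pS | Sp] := leqP p #|subsums T|.*2.
  case/properP: pTA => _ [a aA aT]; exists (a |: T).
    by rewrite cardsU1 aT cT subUset sub1set aA TA.
  apply/orP; left; apply: leq_trans pS _; rewrite leq_double.
  by apply: leq_trans (card_subsumsU1 aT); exact: leq_addr.
have [a /setDP[aA aT] /= H] := subsums_step A0 AN pTA Sp.
exists (a |: T); first by rewrite cardsU1 aT cT subUset sub1set aA TA.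
move: H; rewrite cD /= leqNgt Sp /= in sT *.
move: #|subsums T| #|subsums (a |: T)| sT => s s' sT.
have [sl h | sl h] := leqP s.
  case/orP: sT => [|e]; first by move=> ?; apply/orP; right; apply/orP; left; lia.
  apply/orP; right; apply/orP; right; rewrite expnS.
  move: (2 ^ i)%N e => e; rewrite -!mulnn; nia.
by apply/orP; right; apply/orP; left; lia.
Qed.

Lemma card_subsums A j : 0 \notin A -> (forall a, a \in A -> - a \notin A) ->
    (#|A| <= 2 ^ j)%N -> (4 * p <= (#|A| - j.*2) ^ 2)%N ->
  (p <= #|subsums A|.*2)%N.
Proof.
move=> A0 AN Aj Ap; set K := (#|A| - j.*2)%N in Ap.
have p0 := prime_gt0 p_pr.
have jA : (j.*2 <= #|A|)%N.
  by rewrite leqNgt; apply/negP=> lt; move: Ap; rewrite (_ : K = 0%N) //; rewrite /K; lia.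
have mono (T : {set F}) : T \subset A -> (#|subsums T| <= #|subsums A|)%N.
  move=> TA; apply: subset_leq_card; apply: imsetS.
  by apply/subsetP=> U; rewrite !powersetE => /subset_trans; apply.
suff [T TA h] : exists2 T : {set F}, T \subset A &
    (p <= #|subsums T|.*2)%N || (K ^ 2 <= 8 * #|subsums T|)%N.
  by have := mono T TA; case/orP: h; lia.
suff H n : (n <= K)%N -> exists2 T : {set F}, T \subset A /\ #|T| = (j.*2 + n)%N &
    (p <= #|subsums T|.*2)%N ||
      (K - n <= #|subsums T|)%N && (K ^ 2 <= 8 * #|subsums T| + (K - n) ^ 2)%N.
  have [T [TA _]] := H K (leqnn K).
  by rewrite subnn addn0 => h; exists T => //; case/orP: h => [->//|/andP[_ ->]]; rewrite orbT.
elim: n => [_|n IHn nK].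
  have [T [TA cT] sT] := card_subsums_doubling A0 AN jA.
  exists T; first by rewrite addn0.
  case/or3P: sT => [->//|sT|sT]; rewrite subn0 leq_addl andbT -/K ?sT ?orbT //.
  have : (2 ^ j <= #|subsums T|)%N by rewrite -leq_sqr -expnM muln2.
  by move=> h; apply/orP; right; rewrite /K; lia.
have [T [TA cT] sT] := IHn (ltnW nK).
have cD : #|A :\: T| = (K - n)%N by rewrite cardsD (setIidPr TA) cT /K; lia.
have pTA : T \proper A by rewrite properEcard TA cT; rewrite /K in nK; lia.
have [pS | Sp] := leqP p #|subsums T|.*2.
  case/properP: pTA => _ [a aA aT]; exists (a |: T).
    by rewrite cardsU1 aT cT subUset sub1set aA TA addnS.
  apply/orP; left; apply: leq_trans pS _; rewrite leq_double.
  by apply: leq_trans (card_subsumsU1 aT); exact: leq_addr.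
have [a /setDP[aA aT] /= H] := subsums_step A0 AN pTA Sp.
exists (a |: T); first by rewrite cardsU1 aT cT subUset sub1set aA TA addnS.
move: H; rewrite cD /= leqNgt Sp /= in sT *.
move: #|subsums T| #|subsums (a |: T)| sT => s s' /andP[s1 s2].
(* The case s <= l can only occur here with s = l, where a growth by the factor 3 / 2 also exceeds l
   / 4. *)
move=> H; apply/orP; right; have ss' : (s * 4 + (K - n) < s' * 4)%N.
  by move: H; case: (leqP s (K - n)%N) => //; lia.
apply/andP; split; first by lia.
have -> : (K - n.+1 = (K - n).-1)%N by lia.
move: (K ^ 2)%N (K - n)%N s2 ss' (subn_gt0 n K) => k2 l; rewrite nK.
by case: l => // l; rewrite -!mulnn /=; nia.
Qed.

End PrimeField.

(** Each half of [Q] has more than p / 2 subset sums of inverses, strictly because [p] is odd. The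
    pigeonhole principle then writes [r] as a sum of one from each half. *)
Lemma odd_inverse_sums_cover (p : nat) (Q : seq nat) (j k : nat) (r : 'F_p) :
  prime p -> odd p -> uniq Q -> (forall q, q \in Q -> odd q && (q < p)%N) ->
  size Q = k.*2 -> (k <= 2 ^ j)%N -> (4 * p <= (k - j.*2) ^ 2)%N ->
  exists2 I, subseq I Q & \sum_(q <- I) (q%:R)^-1 = r.
Proof.
move=> p_pr podd uQ Qp sQ kj kp.
have [k0 p0] : (0 < k)%N /\ (0 < p)%N.
  by split; last exact: prime_gt0; case: k kp {sQ kj} => //; have := prime_gt0 p_pr; lia.
pose f (q : nat) : 'F_p := (q%:R)^-1.
have fK q : q \in Q -> nat_of_ord (f q)^-1 = q.
  by case/Qp/andP=> _ qp; rewrite invrK val_Fp_nat // modn_small.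
have finj : {in Q &, injective f} by move=> q q' qQ q'Q e; rewrite -[LHS]fK // e fK.
have cover Q' : subseq Q' Q -> size Q' = k -> exists2 S : {set 'F_p}, (p < #|S|.*2)%N &
    forall x, x \in S -> exists2 I, subseq I Q' & \sum_(q <- I) f q = x.
  move=> sub sQ'; have Q'Q := mem_subseq sub.
  have uA : uniq (map f Q').
    by rewrite map_inj_in_uniq ?(subseq_uniq sub) // => q q' /Q'Q + /Q'Q; apply: finj.
  pose A := [set x in map f Q'].
  have cA : #|A| = k by rewrite cardsE (card_uniqP uA) size_map.
  have fN0 q : q \in Q -> f q != 0.
    by move=> qQ; apply: contraTneq (Qp _ qQ) => f0; rewrite -[q in odd q]fK // f0 invr0.
  exists (subsums A).
    have : (p <= #|subsums A|.*2)%N.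
      apply: (@card_subsums _ _ _ j); rewrite ?cA //.
        by rewrite inE; apply/mapP=> [[q /Q'Q /fN0 /eqP + /esym]].
      move=> a; rewrite !inE => /mapP[q /Q'Q qQ ->]; apply/mapP=> [[q' /Q'Q q'Q]].
      rewrite /f -invrN => /invr_inj/eqP; rewrite eq_sym -addr_eq0 -natrD => /eqP/(congr1 val).
      rewrite /= val_Fp_nat // => /eqP; rewrite -/(dvdn p _) => /dvdnP[c cE].
      case/andP: (Qp _ qQ) => oq qp; case/andP: (Qp _ q'Q) => oq' q'p.
      (* No two inverses are opposite: q + q' would be a positive multiple of [p] below 2 p, hence
         equal to the odd number [p], whereas it is even. *)
      have c1 : c = 1%N by move: cE oq; case: c => [|[|c]]; nia.
      by move: (congr1 odd cE); rewrite c1 mul1n oddD oq oq' podd.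
    by rewrite leq_eqVlt => /orP[/eqP pE|//]; rewrite pE odd_double in podd.
  move=> x /imsetP[T TA ->]; exists [seq q <- Q' | f q \in T]; first exact: filter_subseq.
  rewrite -(big_map f xpredT id) big_uniq /=; last first.
    by apply: subseq_uniq uA; apply: map_subseq; exact: filter_subseq.
  apply: eq_bigl => a; apply/mapP/idP => [[q + ->]|aT].
    by rewrite mem_filter => /andP[].
  have : a \in A by apply: subsetP aT; rewrite -powersetE.
  by rewrite inE => /mapP[q qQ' aE]; exists q; rewrite // mem_filter qQ' -aE aT.
have [||S1 S1p S1I] := cover (take k Q).
- by rewrite -{2}[Q](cat_take_drop k) prefix_subseq.
- by rewrite size_takel // sQ -addnn leq_addr.
have [||S2 S2p S2I] := cover (drop k Q).
- by rewrite -{2}[Q](cat_take_drop k) suffix_subseq.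
- by rewrite size_drop sQ -addnn addnK.
have big : (#|'F_p| < #|S1| + #|S2|)%N by rewrite card_Fp //; lia.
have [x [y [/S1I[I1 sI1 <-] /S2I[I2 sI2 <-] <-]]] := sumset_pigeonhole r big.
exists (I1 ++ I2); last by rewrite big_cat.
by rewrite -[Q](cat_take_drop k) cat_subseq.
Qed.

(** * Chebyshev's lower bound and the sum of the reciprocals of the primes *)

Local Close Scope ring_scope.

(** Induction from (n + 1) C(2n + 2, n + 1) = 2 (2n + 1) C(2n, n). *)
Lemma central_bin_ge n : 0 < n -> 4 ^ n <= n.*2 * 'C(n.*2, n).
Proof.
elim: n => // -[|n] IHn _ //; have {IHn} := IHn isT.
move: (n.+1) (ltn0Sn n) => {}n n0 IHn.
have h1 := mul_bin_diag n.+1.*2 n; have h2 := mul_bin_down n.*2.+1 n.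
have e1 : n.*2.+1 - n = n.+1 by lia.
rewrite e1 /= in h1 h2; rewrite expnS.
apply: leq_trans (_ : 4 * (n.*2 * 'C(n.*2, n)) <= _); first by rewrite leq_mul2l.
rewrite doubleS /= in h1 *.
move: 'C(_, _) 'C(_, n) 'C(_, n) h1 h2 => b d c h1 h2.
have h3 : b = 2 * c.
  by apply/eqP; rewrite -(eqn_pmul2l (ltn0Sn n)) -h1 mulnCA mulnA mul2n doubleS.
by rewrite h3; move: h2; rewrite -!muln2; nia.
Qed.

(** In Legendre's formula the term floor(2n / p^k) - 2 floor(n / p^k) is at most 1, and it vanishes
    when p^k > 2n. So the exponent is at most the integer logarithm [T] of 2n in base [p]. *)
Lemma logn_central_bin p n : prime p -> 0 < n ->
  p ^ logn p 'C(n.*2, n) <= n.*2.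
Proof.
move=> p_pr n0; have p1 := prime_gt1 p_pr.
have n20 : 0 < n.*2 by lia.
apply: leq_trans (trunc_logP p1 n20); rewrite leq_exp2l //.
have nn : n <= n.*2 by lia.
have := congr1 (logn p) (bin_fact nn).
rewrite (_ : n.*2 - n = n); last by lia.
rewrite !lognM ?muln_gt0 ?fact_gt0 ?bin_gt0 ?nn // !logn_fact // addnn.
(* The terms with k > n vanish; adding them gives both sums the same range. *)
have -> : \sum_(1 <= k < n.+1) n %/ p ^ k = \sum_(1 <= k < n.*2.+1) n %/ p ^ k.
  rewrite [RHS](@big_cat_nat _ _ _ n.+1) //=.
  rewrite [X in _ = _ + X]big1_seq ?addn0 // => k; rewrite mem_index_iota => /and3P[_ nk _].
  by rewrite divn_small // (leq_trans nk) // ltnW // ltn_expl.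
move=> e; set T := trunc_log p n.*2.
have Tn : T <= n.*2.
  by rewrite -ltnS; apply: leq_trans (ltn_expl T p1) _; apply: leq_trans (trunc_logP p1 n20) _.
have term k : n.*2 %/ p ^ k <= (n %/ p ^ k).*2 + (k <= T).
  have pk0 : 0 < p ^ k by rewrite expn_gt0 ltnW.
  have [kT|Tk] := leqP k T.
    rewrite -ltnS ltn_divLR //; have := ltn_ceil n pk0; move: (p ^ k) (n %/ _) => a b.
    by rewrite -!muln2; nia.
  rewrite divn_small //; apply: leq_trans (trunc_log_ltn n.*2 p1) _.
  by rewrite leq_exp2l.
have : \sum_(1 <= k < n.*2.+1) n.*2 %/ p ^ k <=
       (\sum_(1 <= k < n.*2.+1) n %/ p ^ k).*2 + T.
  apply: (@leq_trans (\sum_(1 <= k < n.*2.+1) ((n %/ p ^ k).*2 + (k <= T)))).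
    by apply: leq_sum => k _; apply: term.
  rewrite big_split /= -[X in _ <= X + _]muln2 big_distrl /=.
  apply: leq_add; first by apply: leq_sum => k _; rewrite muln2.
  rewrite (@big_cat_nat _ _ _ T.+1) //= ?ltnS //.
  rewrite [X in _ + X]big1_seq ?addn0.
    rewrite big_seq (eq_bigr (fun=> 1)) -?big_seq ?sum_nat_const_nat ?subn1 ?muln1 //.
    by move=> k; rewrite mem_index_iota ltnS => /andP[_ ->].
  by move=> k; rewrite mem_index_iota => /and3P[_ Tk _]; rewrite leqNgt Tk.
by rewrite -e -addnn; lia.
Qed.

Definition primes_le x : seq nat := [seq q <- iota 0 x.+1 | prime q].

Lemma mem_primes_le x q : (q \in primes_le x) = prime q && (q <= x).
Proof. by rewrite mem_filter mem_iota add0n ltnS. Qed.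

Lemma primes_le_uniq x : uniq (primes_le x).
Proof. by rewrite filter_uniq ?iota_uniq. Qed.

Lemma central_bin_le n : 0 < n -> 'C(n.*2, n) <= n.*2 ^ size (primes_le n.*2).
Proof.
move=> n0; have C0 : 0 < 'C(n.*2, n) by rewrite bin_gt0; lia.
rewrite {1}(prod_prime_decomp C0) prime_decompE big_map /=.
apply: (@leq_trans (\prod_(q <- primes 'C(n.*2, n)) n.*2)).
  rewrite big_seq [X in _ <= X]big_seq; apply: leq_prod => q.
  by rewrite mem_primes => /andP[q_pr _]; apply: logn_central_bin.
rewrite big_const_seq count_predT iter_muln_1 leq_exp2l; last by lia.
apply: uniq_leq_size; first exact: primes_uniq.
move=> q; rewrite mem_primes mem_primes_le => /and3P[q_pr _ qC]; rewrite q_pr /=.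
have nn : n <= n.*2 by lia.
have : q %| (n.*2)`! by rewrite -(bin_fact nn) dvdn_mulr.
rewrite fact_prod Euclid_dvd_prod // big_has => /hasP[i].
rewrite mem_index_iota => /andP[i0 i2] /dvdn_leq; lia.
Qed.

(** With 2n = 2^j the two bounds on the central binomial coefficient give 2^(2n) <= (2n)^(pi(2n) +
    1); both sides are powers of 2. *)
Lemma chebyshev j : 0 < j -> 2 ^ j <= j * (size (primes_le (2 ^ j))).+1.
Proof.
case: j => // j _; have j0 : 0 < 2 ^ j by rewrite expn_gt0.
have e : (2 ^ j).*2 = 2 ^ j.+1 by rewrite expnS mul2n.
have := leq_trans (central_bin_ge j0) (leq_mul (leqnn _) (central_bin_le j0)).
rewrite e -expnS -expnM -[4]/(2 ^ 2) -expnM leq_exp2l //.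
by rewrite mul2n e.
Qed.

Local Open Scope ring_scope.

Definition recip_sum (s : seq nat) : rat := \sum_(m <- s) m%:R^-1.

Lemma recip_sum_ge0 s : 0 <= recip_sum s.
Proof. by apply: sumr_ge0 => m _; rewrite invr_ge0 ler0n. Qed.

Lemma recip_sum_cat s t : recip_sum (s ++ t) = recip_sum s + recip_sum t.
Proof. exact: big_cat. Qed.

Lemma ler_recip_sum_uniq s t : uniq s -> {subset s <= t} -> recip_sum s <= recip_sum t.
Proof.
elim: s t => [|m s IHs] t /=; first by rewrite /recip_sum big_nil recip_sum_ge0.
case/andP=> ms us st; have mt := st m (mem_head _ _).
have -> : recip_sum t = m%:R^-1 + recip_sum (rem m t).
  by rewrite /recip_sum (perm_big _ (perm_to_rem mt)) big_cons.
rewrite /recip_sum big_cons lerD2l; apply: IHs => // n ns.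
have nm : n != m by apply: contraNneq ms => <-.
by have := st n; rewrite inE ns orbT (perm_mem (perm_to_rem mt)) inE (negPf nm) => /(_ isT).
Qed.

Lemma recip_sum_ge s (M : nat) : (forall m, m \in s -> (0 < m <= M)%N) ->
  (size s)%:R / M%:R <= recip_sum s.
Proof.
elim: s => [|m s IHs] sM; first by rewrite mul0r recip_sum_ge0.
rewrite /recip_sum big_cons /= -natr1 mulrDl addrC mul1r; apply: lerD.
  have /andP[m0 mM] := sM m (mem_head _ _).
  by rewrite lef_pV2 ?posrE ?ltr0n ?ler_nat // (leq_trans m0).
by apply: IHs => n ns; apply: sM; rewrite inE ns orbT.
Qed.

Lemma recip_sum_le s (M : nat) : (0 < M)%N -> (forall m, m \in s -> (M <= m)%N) ->
  recip_sum s <= (size s)%:R / M%:R.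
Proof.
move=> M0; elim: s => [|m s IHs] sM; first by rewrite /recip_sum big_nil mul0r.
rewrite /recip_sum big_cons /= -natr1 mulrDl addrC mul1r; apply: lerD.
  by apply: IHs => n ns; apply: sM; rewrite inE ns orbT.
have mM := sM m (mem_head _ _).
by rewrite lef_pV2 ?posrE ?ltr0n ?ler_nat // (leq_trans M0).
Qed.

Lemma primes_le_cat x y : (x <= y)%N ->
  primes_le y = primes_le x ++ [seq q <- iota x.+1 (y - x) | prime q].
Proof. by move=> xy; rewrite -filter_cat -iotaD addSn subnKC. Qed.

(* Abel summation over dyadic blocks: subtracting the boundary term makes the
   block increments bounded below by pi(2^m) / 2^(m+1). *)
Definition dyadic_sum (m : nat) : rat :=
  recip_sum (primes_le (2 ^ m)) - (size (primes_le (2 ^ m)))%:R / (2 ^ m)%:R.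

(** Since [chebyshev] gives pi(2^m) + 1 >= 2^m / m, the increment pi(2^m) / 2^(m+1) is at least 1 /
    (2m) - 1 / 2^(m+1), and 2m <= 2^m. *)
Lemma dyadic_sum_step m : (0 < m)%N -> dyadic_sum m + (4 * m)%:R^-1 <= dyadic_sum m.+1.
Proof.
move=> m0; have cheb := chebyshev m0; rewrite /dyadic_sum.
have le2 : (2 ^ m <= 2 ^ m.+1)%N by rewrite leq_exp2l.
rewrite (primes_le_cat le2) recip_sum_cat size_cat.
set new := [seq _ <- _ | _].
have := @recip_sum_ge new (2 ^ m.+1); rewrite -/new => /(_ _) new_ge.
have {}new_ge : (size new)%:R / (2 ^ m.+1)%:R <= recip_sum new.
  apply: new_ge => q; rewrite mem_filter mem_iota addSn subnKC // ltnS.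
  by case/andP=> /prime_gt0 -> /andP[_ ->].
set pi := size (primes_le _) in cheb *.
have M0 : 0 < (2 ^ m)%:R :> rat by rewrite ltr0n expn_gt0.
have M2 : (2 ^ m.+1)%:R = 2 * (2 ^ m)%:R :> rat by rewrite expnS natrM.
have mM : 2 * m%:R <= (2 ^ m)%:R :> rat.
  rewrite -natrM ler_nat; case: (m) m0 => // k _; rewrite expnS leq_mul2l /=.
  exact: ltn_expl.
have {}cheb : (2 ^ m)%:R <= m%:R * (pi%:R + 1) :> rat.
  by rewrite natr1 -natrM ler_nat.
have m0' : 0 < m%:R :> rat by rewrite ltr0n.
rewrite natrM M2 in new_ge *; rewrite natrD.
move: (2 ^ m)%:R m%:R (size new)%:R pi%:R M0 mM cheb m0' new_ge => M k n P M0 kM cheb k0 new_ge.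
have h : (4 * k)^-1 <= P / (2 * M).
  rewrite ler_pdivlMr; last by rewrite mulr_gt0.
  rewrite mulrC ler_pdivrMr; last by rewrite mulr_gt0.
  lra.
have e : P / M = 2 * (P / (2 * M)) by field; rewrite gt_eqF.
have e' : (P + n) / (2 * M) = P / (2 * M) + n / (2 * M) by rewrite mulrDl.
rewrite e e'; lra.
Qed.

Lemma dyadic_sum_steps m n M : (0 < m)%N -> (m + n <= M)%N ->
  dyadic_sum m + n%:R / (4 * M)%:R <= dyadic_sum (m + n).
Proof.
move=> m0; elim: n => [|n IHn] mM; first by rewrite mul0r addr0 addn0.
rewrite addnS; have mn0 : (0 < m + n)%N by rewrite ltn_addr.
apply: le_trans (dyadic_sum_step mn0); rewrite -natr1 mulrDl addrA mul1r.
apply: lerD; first by apply: IHn; rewrite ltnW // -addnS.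
by rewrite lef_pV2 ?posrE ?ltr0n ?ler_nat; lia.
Qed.

(** As for the harmonic series: from m = c to m = 2c there are c increments of at least 1 / (8c)
    each. *)
Lemma dyadic_sum_exp k : k%:R / 8 <= dyadic_sum (2 ^ k).
Proof.
elim: k => [|k IHk].
  by rewrite mul0r /dyadic_sum expn0 expn1 /primes_le /recip_sum /= big_seq1 mul1r subrr.
have k0 : (0 < 2 ^ k)%N by rewrite expn_gt0.
rewrite expnS mul2n -addnn; move: (2 ^ k)%N k0 IHk => c c0 IHk.
apply: le_trans (dyadic_sum_steps c0 (leqnn _)); rewrite -natr1 mulrDl.
apply: lerD => //; rewrite natrM natrD le_eqVlt; apply/orP; left; apply/eqP; field.
by rewrite -natrD pnatr_eq0; lia.
Qed.

Lemma sum_inv_primes_unbounded (K : nat) : exists x, K%:R <= recip_sum (primes_le x).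
Proof.
exists (2 ^ (2 ^ (8 * K)))%N.
have := dyadic_sum_exp (8 * K); rewrite natrM mulrC mulrA mulVf // mul1r => /le_trans; apply.
by rewrite lerBlDr lerDl divr_ge0 // ler0n.
Qed.

(** * The induction step *)

Definition first_primes N : seq nat := [seq nth_prime i | i <- iota 1 N].

Lemma first_primesS N : first_primes N.+1 = rcons (first_primes N) (nth_prime N.+1).
Proof. by rewrite /first_primes -{1}[N.+1]addn1 iotaD map_cat cats1 add1n. Qed.

Lemma mem_first_primes N q : (q \in first_primes N) = prime q && (q <= nth_prime N)%N.
Proof.
elim: N => [|N IHN]; first by case: q => // q; rewrite andbF.
rewrite first_primesS mem_rcons inE IHN nth_primeS.
have [lt_p p_pr p_min] := next_primeP (nth_prime N).
apply/orP/andP=> [[/eqP->|/andP[-> qN]]|[q_pr qN]]; first by rewrite leqnn.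
  by rewrite (leq_trans qN) // ltnW.
have [le|gt] := leqP q (nth_prime N); first by rewrite q_pr; right.
by left; rewrite eqn_leq qN p_min.
Qed.

Lemma nth_primeS_notin N : nth_prime N.+1 \notin first_primes N.
Proof.
rewrite mem_first_primes negb_and -ltnNge nth_primeS.
by case: (next_primeP (nth_prime N)) => ->; rewrite orbT.
Qed.

Lemma first_primes_uniq N : uniq (first_primes N).
Proof.
elim: N => // N IHN; rewrite first_primesS rcons_uniq IHN andbT.
exact: nth_primeS_notin.
Qed.

Lemma size_first_primes N : size (first_primes N) = N.
Proof. by rewrite size_map size_iota. Qed.

Lemma first_primes_gt0 N q : q \in first_primes N -> (0 < q)%N.
Proof. by rewrite mem_first_primes => /andP[/prime_gt0]. Qed.

(** Grouped by the larger prime factor, so that passing to the next prime only appends its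
    multiples. *)
Fixpoint products N : seq nat :=
  if N is N'.+1 then products N' ++ [seq (nth_prime N * q)%N | q <- first_primes N'] else [::].

Lemma mem_products N m : m \in products N ->
  exists q q', [/\ q \in first_primes N, q' \in first_primes N, q != q' & m = (q * q')%N].
Proof.
elim: N => // N IHN /=; rewrite mem_cat first_primesS.
case/orP=> [/IHN[q [q' [qN q'N qq' mE]]] | /mapP[q qN mE]].
  by exists q, q'; rewrite !mem_rcons !inE qN q'N !orbT.
exists (nth_prime N.+1), q; rewrite !mem_rcons !inE qN eqxx orbT; split=> //.
by apply: contraNneq (nth_primeS_notin N) => ->.
Qed.

Lemma products_uniq N : uniq (products N).
Proof.
elim: N => // N IHN /=; have p_pr : prime (nth_prime N.+1) by apply: prime_nth_prime.
rewrite cat_uniq IHN map_inj_uniq ?first_primes_uniq ?andbT /=; last first.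
  by move=> q q' /eqP; rewrite eqn_pmul2l ?prime_gt0 // => /eqP.
apply/hasPn=> _ /mapP[q qN ->]; apply/negP=> /mem_products[r [r' [rN r'N _ e]]].
have : (nth_prime N.+1 %| r * r')%N by rewrite -e dvdn_mulr.
have := nth_primeS_notin N.
move: rN r'N; rewrite Euclid_dvdM // !mem_first_primes => /andP[r_pr rN] /andP[r'_pr r'N].
rewrite p_pr /= -ltnNge => pN; rewrite !dvdn_prime2 //.
by case/orP=> /eqP pE; move: pN; rewrite pE ltnNge ?rN ?r'N.
Qed.

Lemma B_rec N : B N.+1 = B N + recip_sum (first_primes N) / (nth_prime N.+1)%:R.
Proof.
rewrite /B big_nat_recr //= [X in _ + X]big_geq // addr0.
rewrite (eq_big_nat _ _ (F2 := fun i => \sum_(i.+1 <= j < N.+1)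
    1 / ((nth_prime i)%:R * (nth_prime j)%:R) +
    1 / ((nth_prime i)%:R * (nth_prime N.+1)%:R))); last first.
  by move=> i /andP[i1 iN]; rewrite big_nat_recr.
rewrite big_split /=; congr (_ + _).
rewrite /recip_sum big_map mulr_suml /index_iota subn1 /=.
by apply: eq_bigr => i _; rewrite div1r invfM.
Qed.

Lemma recip_sum_mul p s : recip_sum [seq (p * q)%N | q <- s] = recip_sum s / p%:R.
Proof.
rewrite /recip_sum big_map mulr_suml; apply: eq_bigr => q _.
by rewrite natrM invfM mulrC.
Qed.

Lemma B_products N : B N = recip_sum (products N).
Proof.
elim: N => [|N IHN]; first by rewrite /B big_geq // /recip_sum big_nil.
by rewrite B_rec IHN /= recip_sum_cat recip_sum_mul.
Qed.

Definition primorial N : nat := \prod_(q <- first_primes N) q.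

Lemma primorialS N : primorial N.+1 = (nth_prime N.+1 * primorial N)%N.
Proof. by rewrite /primorial first_primesS -cats1 big_cat big_seq1 mulnC. Qed.

Lemma primorial_gt0 N : (0 < primorial N)%N.
Proof. by rewrite /primorial big_seq prodn_cond_gt0 // => q /first_primes_gt0. Qed.

Lemma dvdn_primorial N q : q \in first_primes N -> (q %| primorial N)%N.
Proof.
by move=> qN; rewrite /primorial (perm_big _ (perm_to_rem qN)) big_cons dvdn_mulr.
Qed.

Lemma dvdn_primorial_products N m : m \in products N -> (m %| primorial N)%N.
Proof.
case/mem_products=> q [q' [qN q'N qq' ->]].
rewrite Gauss_dvd ?dvdn_primorial //.
move: qN q'N; rewrite !mem_first_primes => /andP[q_pr _] /andP[q'_pr _].
by rewrite prime_coprime // dvdn_prime2.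
Qed.

Lemma recip_sum_mul_common (s : seq nat) (P : nat) : (0 < P)%N ->
  (forall m, m \in s -> (m %| P)%N) ->
  recip_sum s * P%:R = (\sum_(m <- s) P %/ m)%:R.
Proof.
move=> P0 sP; rewrite /recip_sum mulr_suml natr_sum.
rewrite big_seq [RHS]big_seq; apply: eq_bigr => m /sP mP.
have m0 : m%:R != 0 :> rat by rewrite pnatr_eq0 -lt0n (dvdn_gt0 P0).
by rewrite -{1}(divnK mP) natrM mulrC mulfK.
Qed.

Definition rep N (x : rat) : Prop :=
  exists s, [/\ uniq s, {subset s <= products N} & x = recip_sum s].

Lemma rep_sum N x : rep N x -> is_sum_of_two_prime_unit_fractions x.
Proof.
case=> s [us sN ->]; exists s; split=> //; last first.
  by apply: eq_bigr => m _; rewrite div1r.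
move=> m /sN/mem_products[q [q' [qN q'N qq' ->]]]; exists q, q'.
by move: qN q'N; rewrite !mem_first_primes => /andP[-> _] /andP[-> _].
Qed.

Lemma rep0 N : rep N 0.
Proof. by exists [::]; split=> //; rewrite /recip_sum big_nil. Qed.

Lemma rep_compl N x : rep N x -> rep N (B N - x).
Proof.
case=> s [us sN ->]; exists [seq m <- products N | m \notin s].
split; first by rewrite filter_uniq ?products_uniq.
  by move=> m; rewrite mem_filter => /andP[].
apply/eqP; rewrite subr_eq B_products addrC -recip_sum_cat; apply/eqP.
rewrite /recip_sum; apply: perm_big; apply: uniq_perm; first exact: products_uniq.
  rewrite cat_uniq us filter_uniq ?products_uniq // andbT.
  by apply/hasPn=> m; rewrite mem_filter => /andP[].
by move=> m; rewrite mem_cat mem_filter; case: (boolP (m \in s)) => //= /sN ->.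
Qed.

Lemma rep_step N x I : rep N x -> uniq I -> {subset I <= first_primes N} ->
  rep N.+1 (x + recip_sum I / (nth_prime N.+1)%:R).
Proof.
case=> s [us sN ->] uI IN; have p_pr : prime (nth_prime N.+1) by apply: prime_nth_prime.
exists (s ++ [seq (nth_prime N.+1 * q)%N | q <- I]); split.
- rewrite cat_uniq us map_inj_uniq ?uI ?andbT /=; last first.
    by move=> q q' /eqP; rewrite eqn_pmul2l ?prime_gt0 // => /eqP.
  apply/hasPn=> _ /mapP[q qI ->]; apply/negP=> /sN h.
  have := products_uniq N.+1; rewrite /= cat_uniq => /and3P[_ /hasPn/(_ _)].
  by move/(_ _ (map_f _ (IN _ qI))); rewrite h.
- move=> m; rewrite mem_cat /= mem_cat => /orP[/sN->//|/mapP[q /IN qN ->]].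
  by rewrite map_f ?orbT.
by rewrite recip_sum_cat recip_sum_mul.
Qed.

Definition repn N n : Prop := rep N (n%:R / (primorial N)%:R).

Lemma repn_step N n I : repn N n -> uniq I -> {subset I <= first_primes N} ->
  repn N.+1 (nth_prime N.+1 * n + \sum_(q <- I) primorial N %/ q)%N.
Proof.
move=> /rep_step h uI IN; have {}h := h I uI IN; rewrite /repn.
have P0 := primorial_gt0 N; have p0 : (0 < nth_prime N.+1)%N by rewrite prime_gt0 ?prime_nth_prime.
move: h; rewrite natrD -recip_sum_mul_common //; last by move=> m /IN; exact: dvdn_primorial.
congr rep; rewrite primorialS !natrM; field.
by rewrite !pnatr_eq0 -!lt0n P0 p0.
Qed.

Definition complete N (a : rat) : Prop := forall n,
  a <= n%:R / (primorial N)%:R <= B N - a -> repn N n.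

Definition covers N (C : rat) : Prop := forall r : 'F_(nth_prime N.+1),
  exists I, [/\ uniq I, {subset I <= first_primes N}, recip_sum I <= C &
                \sum_(q <- I) (q%:R)^-1 = r].

(** Up to B_N - a, a sum over [p] is split off and the quotient is a numerator of level [N] in the
    old range. Above that, the complement with respect to B_(N+1) falls back into the first case;
    this is where the last hypothesis enters. *)
Lemma complete_step N a C a' : 0 <= a -> complete N a -> covers N C ->
  a + C / (nth_prime N.+1)%:R <= a' -> B N.+1 <= 2 * (B N - a) -> complete N.+1 a'.
Proof.
move=> a0 compN covN aa' BN; set p := nth_prime N.+1 in covN aa'.
have p_pr : prime p by apply: prime_nth_prime.
have p0 : 0 < p%:R :> rat by rewrite ltr0n prime_gt0.
have P0 : 0 < (primorial N)%:R :> rat by rewrite ltr0n primorial_gt0.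
have P'E : (primorial N.+1)%:R = p%:R * (primorial N)%:R :> rat by rewrite primorialS natrM.
have half n : a' <= n%:R / (primorial N.+1)%:R <= B N - a -> repn N.+1 n.
  (* Modulo [p], [s] is P_N times the sum of the inverses over [I], so the target residue n / P_N
     makes [s] congruent to [n]. *)
  case/andP=> an nB; have [I [uI IN IC Ir]] := covN (n%:R / (primorial N)%:R).
  set s := (\sum_(q <- I) primorial N %/ q)%N.
  have IP q : q \in I -> (q %| primorial N)%N by move/IN/dvdn_primorial.
  have sE : recip_sum I * (primorial N)%:R = s%:R by rewrite recip_sum_mul_common ?primorial_gt0.
  have I0 := recip_sum_ge0 I.
  have yE : n%:R / (primorial N.+1)%:R - recip_sum I / p%:R =
            (n%:R - s%:R) / (p%:R * (primorial N)%:R).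
    by rewrite P'E -sE; field; rewrite !gt_eqF.
  have y_ge : a <= (n%:R - s%:R) / (p%:R * (primorial N)%:R).
    rewrite -yE; apply: le_trans (lerB an (lexx _)); rewrite lerBrDr.
    by apply: le_trans aa'; rewrite lerD2l ler_pM2r ?invr_gt0.
  have sn : (s <= n)%N.
    rewrite -(ler_nat rat) -subr_ge0.
    by have := le_trans a0 y_ge; rewrite pmulr_lge0 // invr_gt0 mulr_gt0.
  have P_unit q : q \in first_primes N -> (q%:R : 'F_p) != 0.
    rewrite mem_first_primes => /andP[q_pr qN].
    rewrite -(dvdn_pcharf (pchar_Fp p_pr)) dvdn_prime2 //; apply/eqP=> pE.
    by have := nth_primeS_notin N; rewrite -/p pE mem_first_primes q_pr qN.
  have PF : ((primorial N)%:R : 'F_p) != 0.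
    rewrite /primorial natr_prod big_seq.
    apply: (big_ind (fun x => x != 0)) => [|x y|]; [exact: oner_neq0 | exact: mulf_neq0 |].
    exact: P_unit.
  have /dvdnP[n' n'E] : (p %| n - s)%N.
    rewrite (dvdn_pcharf (pchar_Fp p_pr)) natrB // subr_eq0 /s natr_sum.
    have -> : \sum_(q <- I) (primorial N %/ q)%:R =
              (primorial N)%:R * \sum_(q <- I) (q%:R)^-1 :> 'F_p.
      rewrite mulr_sumr big_seq [RHS]big_seq; apply: eq_bigr => q qI.
      by rewrite -{2}(divnK (IP q qI)) natrM mulfK // P_unit // IN.
    by rewrite Ir mulrC divfK.
  have nE : n = (p * n' + s)%N by rewrite mulnC -n'E subnK.
  rewrite nE; apply: repn_step => //; apply: compN.
  have e : n'%:R / (primorial N)%:R = (n%:R - s%:R) / (p%:R * (primorial N)%:R) :> rat.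
    by rewrite nE natrD addrK natrM; field; rewrite !gt_eqF.
  rewrite e y_ge -yE /=; apply: le_trans nB; rewrite lerBlDr lerDl.
  by rewrite divr_ge0 // ltW.
move=> n /andP[an nB]; have [le|lt] := lerP (n%:R / (primorial N.+1)%:R) (B N - a).
  by apply: half; rewrite an le.
have BE : B N.+1 * (primorial N.+1)%:R = (\sum_(m <- products N.+1) primorial N.+1 %/ m)%:R.
  rewrite B_products recip_sum_mul_common ?primorial_gt0 //.
  exact: dvdn_primorial_products.
have P'0 : 0 < (primorial N.+1)%:R :> rat by rewrite P'E mulr_gt0.
set T := (\sum_(m <- _) _)%N in BE.
have nT : (n <= T)%N.
  rewrite -(ler_nat rat) -BE -ler_pdivrMr //; apply: le_trans nB _.
  rewrite lerBlDr lerDl; apply: le_trans aa'; rewrite addr_ge0 ?divr_ge0 ?(ltW p0) //.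
  have [I [_ _ IC _]] := covN 0; exact: le_trans (recip_sum_ge0 I) IC.
have TE : (T - n)%:R / (primorial N.+1)%:R = B N.+1 - n%:R / (primorial N.+1)%:R.
  by rewrite natrB // mulrBl -BE mulfK // gt_eqF.
have : repn N.+1 (T - n)%N by apply: half; rewrite TE; apply/andP; split; lra.
by move/rep_compl; rewrite TE /repn subKr.
Qed.

Lemma half_le_recip_sum N : (0 < N)%N -> 2^-1 <= recip_sum (first_primes N).
Proof.
case: N => // N _.
apply: le_trans (@ler_recip_sum_uniq [:: 2%N] _ isT _); first by rewrite /recip_sum big_seq1.
move=> q; rewrite inE => /eqP ->; rewrite mem_first_primes /=.
have : (0 < nth_prime N.+1)%N by rewrite prime_gt0 ?prime_nth_prime.
by have := prime_gt1 (prime_nth_prime (ltn0Sn N)).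
Qed.

(** The added term is A_N / p, where A_N <= N / 2 because every prime is at least 2, and N <= p. *)
Lemma B_step_le N : (0 < N)%N -> B N <= B N.+1 <= B N + 2^-1.
Proof.
move=> N0; have p0 : 0 < (nth_prime N.+1)%:R :> rat by rewrite ltr0n prime_gt0 ?prime_nth_prime.
rewrite B_rec; apply/andP; split.
  by rewrite lerDl divr_ge0 ?recip_sum_ge0 // ltW.
rewrite lerD2l ler_pdivrMr //.
have := @recip_sum_le (first_primes N) 2 isT; rewrite size_first_primes => h.
have {h} : recip_sum (first_primes N) <= N%:R / 2.
  by apply: h => q; rewrite mem_first_primes => /andP[/prime_gt1].
move/le_trans; apply; rewrite mulrC ler_pM2l ?invr_gt0 // ler_nat.
by apply: leq_trans (leq_nth_prime _).
Qed.

Lemma B_mono N M : (0 < N)%N -> (N <= M)%N -> B N <= B M.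
Proof.
move=> N0 /subnKC <-; elim: (M - N)%N => [|k IHk]; rewrite ?addn0 // addnS.
by apply: le_trans IHk _; case/andP: (@B_step_le (N + k) (ltn_addr _ N0)).
Qed.

Lemma B_unbounded K N0 : exists2 N, (N0 <= N)%N & K%:R <= B N.
Proof.
have [x xK] := sum_inv_primes_unbounded (2 * K + 1).
pose N := (maxn x N0).+1; exists N; first by rewrite ltnW // ltnS leq_maxr.
(* Each new prime p adds A_N / p >= 1 / (2p) to B. The correction 1/4 makes the inequality start
   with B_1 = 0. *)
have h M : recip_sum (first_primes M.+1) / 2 - 4^-1 <= B M.+1.
  elim: M => [|M IHM].
    have : recip_sum (first_primes 1) <= 1%:R / 2%:R.
      apply: (@recip_sum_le [:: nth_prime 1]) => // q; rewrite inE => /eqP ->.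
      by rewrite prime_gt1 ?prime_nth_prime.
    by have := recip_sum_ge0 (products 1); rewrite -B_products; lra.
  have -> : recip_sum (first_primes M.+2) =
            recip_sum (first_primes M.+1) + (nth_prime M.+2)%:R^-1.
    by rewrite first_primesS -cats1 recip_sum_cat /recip_sum big_seq1.
  rewrite B_rec.
  have := half_le_recip_sum (ltn0Sn M); set p := (nth_prime _)%:R^-1 => h.
  have p0 : 0 <= p by rewrite invr_ge0 ler0n.
  rewrite -/p; have : 2^-1 * p <= recip_sum (first_primes M.+1) * p by rewrite ler_wpM2r.
  by lra.
apply: le_trans (h _); have : recip_sum (primes_le x) <= recip_sum (first_primes N).
  apply: ler_recip_sum_uniq; first exact: primes_le_uniq.
  move=> q; rewrite mem_primes_le mem_first_primes => /andP[-> qx] /=.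
  apply: leq_trans qx _; apply: leq_trans (leq_nth_prime N).
  by rewrite ltnW // ltnS leq_maxl.
by move: xK; rewrite natrD natrM; lra.
Qed.

(** * The nine-prime base case *)

Local Close Scope ring_scope.

Lemma sorted_first_primes N : sorted ltn (first_primes N).
Proof.
elim: N => // N IHN; rewrite first_primesS.
have : all (ltn^~ (nth_prime N.+1)) (first_primes N).
  apply/allP=> q; rewrite mem_first_primes nth_primeS => /andP[_ qN] /=.
  by case: (next_primeP (nth_prime N)) => /(leq_ltn_trans qN).
case: (first_primes N) IHN => //= q s; rewrite rcons_path => -> /andP[qp /allP sp] /=.
by have := mem_last q s; rewrite inE => /orP[/eqP->|/sp].
Qed.

(** Both lists are strictly increasing initial segments of the primes and have the same length. This
    replaces the iteration of [next_prime] by a list that can be computed. *)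
Lemma first_primes_primes_le x : first_primes (size (primes_le x)) = primes_le x.
Proof.
set M := size _.
have sorted_le : sorted ltn (primes_le x).
  exact: sorted_filter ltn_trans _ _ (iota_ltn_sorted _ _).
apply: (irr_sorted_eq ltn_trans ltnn (sorted_first_primes M) sorted_le).
have [pM|pM] := leqP (nth_prime M) x.
  have sub : {subset first_primes M <= primes_le x}.
    by move=> q; rewrite mem_first_primes mem_primes_le => /andP[-> /leq_trans->].
  have := uniq_min_size (first_primes_uniq M) sub.
  by rewrite size_first_primes => /(_ (leqnn _))[].
have sub : {subset primes_le x <= first_primes M}.
  move=> q; rewrite mem_first_primes mem_primes_le => /andP[-> qx] /=.
  exact: leq_trans qx (ltnW pM).
have := uniq_min_size (primes_le_uniq x) sub.
by rewrite size_first_primes => /(_ (leqnn _))[_ e] q; rewrite e.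
Qed.

Lemma first_primes_take N x : N <= size (primes_le x) ->
  first_primes N = take N (primes_le x).
Proof.
move=> Nx; rewrite -first_primes_primes_le /first_primes -map_take.
congr map; rewrite -(subnKC Nx) iotaD take_size_cat ?size_iota //.
Qed.

Lemma nth_prime_nth N x : N < size (primes_le x) -> nth_prime N.+1 = nth 0 (primes_le x) N.
Proof.
move=> Nx; rewrite -first_primes_primes_le /first_primes (nth_map 0) ?size_iota //.
by rewrite nth_iota.
Qed.

Definition total N : nat := \sum_(m <- products N) primorial N %/ m.

Lemma total_B N : (B N = (total N)%:R / (primorial N)%:R)%R.
Proof.
have P0 := primorial_gt0 N.
rewrite B_products /total -recip_sum_mul_common //; last exact: dvdn_primorial_products.
by rewrite mulfK // pnatr_eq0 -lt0n.
Qed.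

Lemma totalS N : total N.+1 =
  nth_prime N.+1 * total N + \sum_(q <- first_primes N) primorial N %/ q.
Proof.
have p0 : 0 < nth_prime N.+1 by rewrite prime_gt0 ?prime_nth_prime.
rewrite /total /= big_cat big_map primorialS /=; congr (_ + _).
  rewrite big_distrr /= big_seq [RHS]big_seq; apply: eq_bigr => m mN.
  by rewrite muln_divA // dvdn_primorial_products.
by apply: eq_bigr => q _; rewrite divnMl.
Qed.

(** * Representable numerators in binary integers *)

Local Open Scope Z_scope.

Lemma Z_of_divn (m d : nat) : Z.of_nat (m %/ d) = Z.of_nat m / Z.of_nat d.
Proof.
case: d => [|d]; first by rewrite divn0 Zdiv_0_r.
apply: (Z.div_unique _ _ _ (Z.of_nat (m %% d.+1))).
  by left; have := ltn_pmod m (ltn0Sn d); lia.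
by rewrite -Nat2Z.inj_mul -Nat2Z.inj_add multE plusE mulnC -divn_eq.
Qed.

Fixpoint all_sums (ws : seq Z) : seq Z :=
  if ws is w :: ws' then
    let r := all_sums ws' in r ++ [seq w + x | x <- r] else [:: 0].

Lemma all_sums0 ws : 0 \in all_sums ws.
Proof. by elim: ws => //= w ws IHws; rewrite mem_cat IHws. Qed.

(** Over the denominator p P the fraction 1 / (p q) has numerator P / q. *)
Definition weights (P : Z) (l : seq nat) : seq Z := [seq P / Z.of_nat q | q <- l].

Lemma mem_all_sums P l s : s \in all_sums (weights (Z.of_nat P) l) ->
  exists2 I, subseq I l & s = Z.of_nat (\sum_(q <- I) P %/ q)%N.
Proof.
elim: l s => [|q l IHl] s /=; first by rewrite inE => /eqP ->; exists [::]; rewrite ?big_nil.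
rewrite mem_cat => /orP[/IHl[I Il ->] | /mapP[x /IHl[I Il ->] ->]].
  by exists I => //; apply: subseq_trans Il (subseq_cons _ _).
exists (q :: I); first by rewrite /= eqxx.
rewrite big_cons; move: (\sum_(_ <- _) _)%N => S.
by rewrite Nat2Z.inj_add Z_of_divn.
Qed.

Definition is_level N (P : Z) (l : seq nat) (p : Z) : Prop :=
  [/\ first_primes N = l, Z.of_nat (primorial N) = P & Z.of_nat (nth_prime N.+1) = p].

(** The sign condition is needed because [Z.to_nat] sends negative integers to 0. *)
Definition repZ N (z : Z) : Prop := 0 <= z /\ repn N (Z.to_nat z).

Lemma repZ_step N P l p z s : is_level N P l p -> repZ N z ->
  s \in all_sums (weights P l) -> repZ N.+1 (p * z + s).
Proof.
case=> lE PE pE [z0 zN]; rewrite -PE => /mem_all_sums[I Il ->].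
have uI : uniq I by rewrite (subseq_uniq Il) // -lE first_primes_uniq.
have IN : {subset I <= first_primes N} by rewrite lE; exact: mem_subseq.
have := repn_step zN uI IN; set S := (\sum_(q <- I) _)%N => h.
split; first by rewrite -pE; nia.
suff -> : Z.to_nat (p * z + Z.of_nat S) = (nth_prime N.+1 * Z.to_nat z + S)%N by [].
by rewrite -pE; nia.
Qed.

Definition next_values (P : Z) (l : seq nat) (p : Z) (vs : seq Z) : seq Z :=
  [seq p * z + s | z <- vs, s <- all_sums (weights P l)].

Lemma next_valuesP N P l p vs : is_level N P l p -> {in vs, forall z, repZ N z} ->
  {in next_values P l p vs, forall z, repZ N.+1 z}.
Proof.
move=> lev vsN _ /allpairsP[[z s] /= [zvs sin ->]].
exact: repZ_step lev (vsN _ zvs) sin.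
Qed.

(* [has] evaluates its test on the whole list under call by value. *)
Fixpoint has_lazy (T : Type) (a : T -> bool) (s : seq T) : bool :=
  if s is x :: s' then if a x then true else has_lazy a s' else false.

Lemma has_lazyE (T : Type) (a : T -> bool) s : has_lazy a s = has a s.
Proof. by elim: s => //= x s ->; case: (a x). Qed.

(** Descends through the levels: at each one a subset sum congruent to [z] modulo [p] is subtracted
    and the rest is divided by [p]. *)
Fixpoint searchZ (base : Z -> bool) (levels : seq (Z * seq Z)) (z : Z) : bool :=
  if levels is (p, ss) :: levels' then
    has_lazy (fun s => if (z - s) mod p =? 0 then searchZ base levels' ((z - s) / p) else false) ss
  else base z.

Lemma searchZ_cons N P l p ss base levels z : is_level N P l p ->
  {subset ss <= all_sums (weights P l)} ->
  (forall z, searchZ base levels z -> repZ N z) ->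
  searchZ base ((p, ss) :: levels) z -> repZ N.+1 z.
Proof.
move=> lev ssP IH /=; rewrite has_lazyE => /hasP[s /ssP sin /andP[/Z.eqb_eq zs /IH h]].
have [_ _ pE] := lev.
have p0 : (0 < nth_prime N.+1)%N by rewrite prime_gt0 ?prime_nth_prime.
suff -> : z = p * ((z - s) / p) + s by apply: repZ_step lev h sin.
have := Z.div_mod (z - s) p; lia.
Qed.

Definition setZ (s : seq Z) : PositiveSet.t :=
  foldl (fun t z => PositiveSet.add (Z.to_pos z) t) PositiveSet.empty s.

Lemma mem_setZ s x : PositiveSet.mem x (setZ s) <-> exists2 z, z \in s & x = Z.to_pos z.
Proof.
rewrite /setZ -[s]revK foldl_rev; move: (rev s) => t {s}.
have -> : (exists2 z, z \in rev t & x = Z.to_pos z) <-> (exists2 z, z \in t & x = Z.to_pos z).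
  by split=> -[z zt ->]; exists z => //; move: zt; rewrite mem_rev.
elim: t => [|z t IHt] /=; first by split=> [|[]].
set f := foldr _ _ t in IHt *.
change (PositiveSet.In x (PositiveSet.add (Z.to_pos z) f) <->
        exists2 y, y \in z :: t & x = Z.to_pos y).
rewrite PositiveSet.add_spec; split=> [[->|/IHt[y yt ->]]|[y]].
- by exists z; rewrite ?mem_head.
- by exists y; rewrite // inE yt orbT.
by rewrite inE => /orP[/eqP-> ->|yt xE]; [left | right; apply/IHt; exists y].
Qed.

(** The shift by one separates 0 from 1, which [Z.to_pos] both sends to 1. *)
Lemma mem_setZ_succ vs z : (forall x, x \in vs -> 0 <= x) ->
  (if 0 <=? z then PositiveSet.mem (Z.to_pos (z + 1)) (setZ [seq x + 1 | x <- vs]) else false) ->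
  z \in vs.
Proof.
move=> vs0; case: Z.leb_spec => // z0 /mem_setZ[y /mapP[x xvs ->] e].
by suff -> : z = x by []; have := vs0 x xvs; lia.
Qed.

(* For each residue r the pair (s0, ds), where s0 is the first subset sum in the
   class r and s0 + p d runs through the others as - d runs through ds. *)
Definition residue_class (p : Z) (ss : seq Z) (r : Z) : Z * seq Z :=
  if [seq s <- ss | s mod p =? r] is s0 :: c then (s0, [seq (s0 - s) / p | s <- c])
  else (-1, [::]).

Fixpoint zrange (lo : Z) (n : nat) : seq Z :=
  if n is n'.+1 then lo :: zrange (lo + 1) n' else [::].

Lemma mem_zrange lo n z : lo <= z < lo + Z.of_nat n -> z \in zrange lo n.
Proof.
elim: n lo => [|n IHn] lo zn /=; first lia.
rewrite inE; have [->//|/eqP ne] := eqVneq z lo.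
by rewrite IHn //; lia.
Qed.

Definition residue_classes p ss := [seq residue_class p ss r | r <- zrange 0 (Z.to_nat p)].

(** A gap at the next level must come from a gap [z] through the first sum of its class, and every
    other sum of the class must lead to a value [z + d] not known to be represented. *)
Definition next_gaps (p lo : Z) (classes : seq (Z * seq Z)) (ok : Z -> bool) (gaps : seq Z) :=
  flatten [seq let lo0 := (lo - c.1) / p in
    [seq p * z + c.1 | z <- gaps &
      if lo0 <=? z then ~~ has_lazy (fun d => ok (z + d)) c.2 else false] | c <- classes].

(** An empty residue class has first component -1 and is rejected. The second test keeps (z - s0) /
    p at or above the old lower end. *)
Definition next_ok (p lo' lo : Z) (classes : seq (Z * seq Z)) : bool :=
  all (fun c => (0 <=? c.1) && (p * lo + c.1 <=? lo')) classes.

Definition covered N lo hi (gaps : seq Z) : Prop :=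
  forall z, lo <= z <= hi -> z \notin gaps -> repZ N z.

Lemma covered_step N P l p ss lo hi lo' (ok : Z -> bool) gaps :
    let classes := residue_classes p ss in
    is_level N P l p -> {subset ss <= all_sums (weights P l)} ->
    covered N lo hi gaps -> (forall z, ok z -> repZ N z) ->
    next_ok p lo' lo classes ->
  covered N.+1 lo' (p * hi) (next_gaps p lo' classes ok gaps).
Proof.
move=> classes lev ssP cov okN /allP nok z [loz zhi]; have [_ _ pE] := lev.
have p0 : (0 < nth_prime N.+1)%N by rewrite prime_gt0 ?prime_nth_prime.
pose r := z mod p; have r_p : 0 <= r < p by apply: Z.mod_pos_bound; lia.
pose c := residue_class p ss r.
have c_in : c \in classes by apply: map_f; apply: mem_zrange; lia.
have mod_eq s s' : s mod p = s' mod p -> s - s' = p * ((s - s') / p).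
  move=> e; have := Z.div_mod (s - s') p; rewrite Zminus_mod e Z.sub_diag Z.mod_0_l; lia.
have cl s : s \in [seq s <- ss | s mod p =? r] -> s \in all_sums (weights P l) /\ z mod p = s mod p.
  by rewrite mem_filter => /andP[/Z.eqb_eq -> /ssP].
have /andP[c0 c_lo] := nok _ c_in.
move: cl c_in c0 c_lo; rewrite {}/c /residue_class.
case: [seq s <- ss | _] => [|s0 c] //= cl c_in c0 c_lo.
have [s0_ss s0_r] := cl _ (mem_head _ _).
pose y := (z - s0) / p; have zE : z = p * y + s0 by have := mod_eq _ _ s0_r; rewrite -/y; lia.
have y_range : lo <= y <= hi by move: c_lo c0; nia.
have [y_gap zgap|y_ok _] := boolP (y \in gaps); last first.
  by rewrite zE; apply: repZ_step lev (cov _ y_range y_ok) s0_ss.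
have : has_lazy (fun d => ok (y + d)) [seq (s0 - s) / p | s <- c].
  apply: contraR zgap => nhas; apply/flattenP; eexists.
    by apply/mapP; eexists; first exact: c_in.
  apply/mapP; exists y => //=; rewrite mem_filter y_gap nhas andbT.
  suff -> : (lo' - s0) / p <=? y by [].
  by apply/Z.leb_spec0; apply: Z.div_le_mono; lia.
rewrite has_lazyE => /hasP[_ /mapP[s sc ->] /okN h].
have [s_ss s_r] : s \in all_sums (weights P l) /\ z mod p = s mod p.
  by apply: cl; rewrite inE sc orbT.
suff -> : z = p * (y + (s0 - s) / p) + s by apply: repZ_step lev h s_ss.
by have := mod_eq s0 s; rewrite -s0_r -s_r => /(_ erefl); lia.
Qed.

Definition level_ok (lo hi : Z) (t : PositiveSet.t) (z : Z) : bool :=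
  if [&& lo <=? z & z <=? hi] then ~~ PositiveSet.mem (Z.to_pos z) t else false.

Lemma level_okP N lo hi gaps z : covered N lo hi gaps ->
  level_ok lo hi (setZ gaps) z -> repZ N z.
Proof.
move=> cov /andP[/andP[lz zh] zt]; apply: cov; first by lia.
by apply: contra zt => zg; apply/mem_setZ; exists z.
Qed.

Definition primesZ (l : seq nat) : Z := foldr (fun q z => Z.of_nat q * z) 1 l.
Definition primes23 := [:: 2; 3; 5; 7; 11; 13; 17; 19; 23]%N.

(** The list has 2^(n (n - 1) / 2) entries: 2^15 for n = 6, but already 2^21 for n = 7. Hence the
    exhaustive list stops at six primes and gaps are tracked from there. *)
Definition values (n : nat) : seq Z :=
  foldl (fun vs k => let l := take k primes23 in
    next_values (primesZ l) l (Z.of_nat (nth 0%N primes23 k)) vs) [:: 0] (iota 0 n).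

(* gaps_N contains every n between a lower end and P_N / 2 such that n / P_N is not
   known to be represented; the lower ends 30000 and 1018000 are low enough to
   leave no gap above 32254391, the least integer that is at least 12 P_9 / 83. *)
Definition set6 := setZ [seq z + 1 | z <- values 6].
Definition ok6 z := if 0 <=? z then PositiveSet.mem (Z.to_pos (z + 1)) set6 else false.
Definition gaps6 := [seq z <- zrange 0 (Z.to_nat 15016) | ~~ ok6 z].

Definition sums6 := sort Z.leb (all_sums (weights 30030 (take 6 primes23))).
Definition classes6 := residue_classes 17 sums6.
Definition gaps7 := next_gaps 17 30000 classes6 ok6 gaps6.
Definition ok7 := level_ok 30000 255255 (setZ gaps7).

Definition sums7 := sort Z.leb (all_sums (weights 510510 (take 7 primes23))).
Definition classes7 := residue_classes 19 sums7.
Definition gaps8 := next_gaps 19 1018000 classes7 ok7 gaps7.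
Definition ok8 := level_ok 1018000 4849845 (setZ gaps8).

Definition sums8 := sort Z.leb (all_sums (weights 9699690 (take 8 primes23))).
Definition classes8 := residue_classes 23 sums8.
Definition gaps9 := next_gaps 23 32254391 classes8 ok8 gaps8.

Definition search := searchZ ok6 [:: (23, sums8); (19, sums7); (17, sums6)].
Definition fast_search := searchZ ok8 [:: (23, sums8)].

(* The multiples of P_8 / P_N that are at least B_N P_8 / 6, for N = 8, 7, 6. *)
Definition low8 z := [|| 1355115 <=? z, (z mod 19 =? 0) && (1235760 <=? z)
                       | (z mod 323 =? 0) && (1108213 <=? z)].

(* 7436429, 1062347 and 96577 are P_9 / P_N for N = 3, 4, 5; the ranges contain all
   n with B_N / 6 <= n / P_N < 12 / 83. *)
Definition base_check : bool :=
  [&& next_ok 17 30000 0 classes6, next_ok 19 1018000 30000 classes7,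
      next_ok 23 32254391 1018000 classes8, nilp gaps9,
      all (fun n => search (n * 7436429)) (zrange 2 3),
      all (fun n => search (n * 1062347)) (zrange 17 14),
      all (fun n => search (n * 96577)) (zrange 227 108) &
      all (fun z => if low8 z then
                      if fast_search (23 * z) then true else search (23 * z)
                    else true) gaps8].

Lemma base_check_true : base_check.
Proof. by vm_compute. Qed.

Lemma level_primes23 k : (k < 9)%N ->
  is_level k (primesZ (take k primes23)) (take k primes23) (Z.of_nat (nth 0%N primes23 k)).
Proof.
move=> k9; have lE : first_primes k = take k primes23 by rewrite (@first_primes_take _ 23) // ltnW.
split=> //; last by rewrite (@nth_prime_nth _ 23).
rewrite /primorial lE; elim: (take k primes23) => [|q l IHl]; rewrite ?big_nil // big_cons /=.
by rewrite -IHl; lia.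
Qed.

Lemma valuesP k : (k < 9)%N -> {in values k, forall z, repZ k z}.
Proof.
elim: k => [|k IHk] k9 z.
  by rewrite /= inE => /eqP ->; split=> //; rewrite /repn mul0r; exact: rep0.
rewrite /values -{1}addn1 iotaD foldl_cat /=; apply: next_valuesP.
  by apply: level_primes23; lia.
by apply: IHk; exact: ltnW.
Qed.

Lemma total_level N P l p : is_level N P l p ->
  Z.of_nat (total N.+1) = p * Z.of_nat (total N) + foldr Z.add 0 (weights P l).
Proof.
case=> lE PE pE; rewrite totalS Nat2Z.inj_add Nat2Z.inj_mul pE; congr (_ + _).
rewrite lE -PE; elim: l {lE} => [|q l IHl]; rewrite ?big_nil // big_cons /=.
by rewrite -IHl -Z_of_divn Nat2Z.inj_add.
Qed.

Lemma total_small : [/\ Z.of_nat (total 3) = 10, Z.of_nat (total 4) = 101,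
  Z.of_nat (total 5) = 1358 & [/\ Z.of_nat (total 6) = 20581,
  Z.of_nat (total 7) = 390238, Z.of_nat (total 8) = 8130689 &
  Z.of_nat (total 9) = 201123530]].
Proof.
have t0 : Z.of_nat (total 0) = 0 by rewrite /total big_nil.
have t1 := total_level (@level_primes23 0 isT); rewrite t0 /= in t1.
have t2 := total_level (@level_primes23 1 isT); rewrite t1 /= in t2.
have t3 := total_level (@level_primes23 2 isT); rewrite t2 in t3.
have t4 := total_level (@level_primes23 3 isT); rewrite t3 in t4.
have t5 := total_level (@level_primes23 4 isT); rewrite t4 in t5.
have t6 := total_level (@level_primes23 5 isT); rewrite t5 in t6.
have t7 := total_level (@level_primes23 6 isT); rewrite t6 in t7.
have t8 := total_level (@level_primes23 7 isT); rewrite t7 in t8.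
have t9 := total_level (@level_primes23 8 isT); rewrite t8 in t9.
by split=> //; split.
Qed.

Lemma level6 : is_level 6 30030 (take 6 primes23) 17.
Proof. exact: (@level_primes23 6 isT). Qed.

Lemma level7 : is_level 7 510510 (take 7 primes23) 19.
Proof. exact: (@level_primes23 7 isT). Qed.

Lemma level8 : is_level 8 9699690 (take 8 primes23) 23.
Proof. exact: (@level_primes23 8 isT). Qed.

Lemma ok6P z : ok6 z -> repZ 6 z.
Proof.
have values_ge0 x : x \in values 6 -> 0 <= x by case/(@valuesP 6 isT).
rewrite /ok6 /set6 => /(mem_setZ_succ values_ge0); exact: (@valuesP 6 isT).
Qed.

Lemma covered6 : covered 6 0 15015 gaps6.
Proof.
move=> z zr zg; apply: ok6P; apply: contraR zg => nok.
by rewrite mem_filter nok; apply: mem_zrange; lia.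
Qed.

Lemma sums_sub P l : {subset sort Z.leb (all_sums (weights P l)) <= all_sums (weights P l)}.
Proof. by move=> s; rewrite mem_sort. Qed.

Lemma if_if_or (a b c : bool) :
  (if a then if b then true else c else true) -> a -> b || c.
Proof. by case: a b => -[]. Qed.

Lemma base_covered :
  [/\ covered 9 32254391 111546435 [::],
      (forall n, 2 <= n <= 4 -> repZ 9 (n * 7436429)),
      (forall n, 17 <= n <= 30 -> repZ 9 (n * 1062347)),
      (forall n, 227 <= n <= 334 -> repZ 9 (n * 96577)) &
      forall z, 1018000 <= z <= 4849845 -> low8 z -> repZ 9 (23 * z)].
Proof.
have /and5P[n7 n8 n9 /nilP g9 /and4P[/allP s3 /allP s4 /allP s5 /allP s8]] := base_check_true.
have cov7 : covered 7 30000 255255 gaps7.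
  exact: covered_step level6 (@sums_sub _ _) covered6 ok6P n7.
have ok7P z : ok7 z -> repZ 7 z by exact: level_okP cov7.
have cov8 : covered 8 1018000 4849845 gaps8.
  exact: covered_step level7 (@sums_sub _ _) cov7 ok7P n8.
have ok8P z : ok8 z -> repZ 8 z by exact: level_okP cov8.
have cov9 : covered 9 32254391 111546435 gaps9.
  exact: covered_step level8 (@sums_sub _ _) cov8 ok8P n9.
have searchP z : search z -> repZ 9 z.
  apply: (searchZ_cons level8 (@sums_sub _ _)) => {}z.
  apply: (searchZ_cons level7 (@sums_sub _ _)) => {}z.
  by apply: (searchZ_cons level6 (@sums_sub _ _)) => {}z; exact: ok6P.
have fastP z : fast_search z -> repZ 9 z.
  by apply: (searchZ_cons level8 (@sums_sub _ _)) => {}z; exact: ok8P.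
split.
- by rewrite -g9.
- by move=> n n_r; apply/searchP/s3/mem_zrange; lia.
- by move=> n n_r; apply/searchP/s4/mem_zrange; lia.
- by move=> n n_r; apply/searchP/s5/mem_zrange; lia.
(* A non-gap of level 8 is already represented there, and 23 z is obtained from it with the empty
   sum. *)
move=> z z_r z_low; have [zg|zg] := boolP (z \in gaps8); last first.
  have := @repZ_step _ _ _ _ z 0 level8 (cov8 _ z_r zg) _; rewrite Z.add_0_r; apply.
  exact: all_sums0.
have h : if low8 z then if fast_search (23 * z) then true else search (23 * z) else true.
  exact: s8 z zg.
have {h}/orP[h|h] := @if_if_or (low8 z) (fast_search (23 * z)) (search (23 * z)) h z_low.
  exact: fastP h.
exact: searchP h.
Qed.

Lemma repZ_scale M N n K : repZ M (Z.of_nat n * K) ->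
  Z.of_nat (primorial M) = K * Z.of_nat (primorial N) ->
  rep M (n%:R / (primorial N)%:R)%R.
Proof.
case=> nK0 + PE; rewrite /repn.
have PN := primorial_gt0 N; have PM := primorial_gt0 M.
have K0 : 0 < K by nia.
have -> : Z.to_nat (Z.of_nat n * K) = (n * Z.to_nat K)%N by lia.
have -> : primorial M = (Z.to_nat K * primorial N)%N by lia.
rewrite !natrM; congr rep; field.
by rewrite !pnatr_eq0; apply/andP; split; lia.
Qed.

Lemma ler_frac (a b c d : nat) : (0 < b)%N -> (0 < d)%N ->
  (a%:R / b%:R <= c%:R / d%:R :> rat)%R = (a * d <= c * b)%N.
Proof.
move=> b0 d0; rewrite ler_pdivrMr ?ltr0n // mulrAC ler_pdivlMr ?ltr0n //.
by rewrite -!natrM ler_nat.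
Qed.

Lemma ltr_frac (a b c d : nat) : (0 < b)%N -> (0 < d)%N ->
  (a%:R / b%:R < c%:R / d%:R :> rat)%R = (a * d < c * b)%N.
Proof. by move=> b0 d0; rewrite ltNge ler_frac // ltnNge. Qed.

Lemma le_B_div6 N n : (B N / 6%:R <= n%:R / (primorial N)%:R :> rat)%R = (total N <= 6 * n)%N.
Proof.
have P0 : (0 < (primorial N)%:R :> rat)%R by rewrite ltr0n primorial_gt0.
rewrite total_B ler_pdivrMr // mulrAC ler_pM2r ?invr_gt0 // -natrM ler_nat mulnC //.
Qed.

Lemma primorial9 : Z.of_nat (primorial 9) = 223092870.
Proof.
have [_ PE _] := level8; have := primorialS 8; rewrite (@nth_prime_nth _ 23) // => P9.
by rewrite P9 /=; lia.
Qed.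

Lemma B9_bounds : (119%:R / 132%:R < B 9 < 1)%R.
Proof.
have [_ _ _ [_ _ _ t9]] := total_small; have P9 := primorial9.
have P0 := primorial_gt0 9.
rewrite total_B ltr_frac // ltr_pdivrMr ?ltr0n // mul1r ltr_nat.
by apply/andP; split; lia.
Qed.

(** Numerators up to P_9 / 2 are covered by the computation. For the others the complement lies
    below P_9 / 2, because B_9 < 1. *)
Lemma base_complete : complete 9 (12%:R / 83%:R).
Proof.
have P0 := primorial_gt0 9; have P9 := primorial9.
have [_ _ _ [_ _ _ t9]] := total_small.
have [cov _ _ _ _] := base_covered.
have low n : (12%:R / 83%:R <= n%:R / (primorial 9)%:R :> rat)%R ->
    (2 * n <= primorial 9)%N -> repn 9 n.
  rewrite ler_frac // => lo hi.
  suff [_] : repZ 9 (Z.of_nat n) by rewrite Nat2Z.id.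
  by apply: cov; [lia | rewrite in_nil].
move=> n /andP[an nB]; have [le|gt] := leqP (2 * n) (primorial 9); first exact: low.
have nT : (n <= total 9)%N.
  have P0' : (0 < (primorial 9)%:R^-1 :> rat)%R by rewrite invr_gt0 ltr0n.
  by rewrite -(ler_nat rat) -(ler_pM2r P0') -total_B; lra.
have e : ((total 9 - n)%:R / (primorial 9)%:R = B 9 - n%:R / (primorial 9)%:R :> rat)%R.
  by rewrite (natrB _ nT) mulrBl -total_B.
have : repn 9 (total 9 - n).
  by apply: low; [rewrite e; lra | lia].
by move/rep_compl; rewrite /repn e subKr.
Qed.

Lemma low_rep N n : (N <= 8)%N -> (0 < n)%N ->
  (B N / 6%:R <= n%:R / (primorial N)%:R :> rat)%R ->
  (n%:R / (primorial N)%:R < 12%:R / 83%:R :> rat)%R -> rep 9 (n%:R / (primorial N)%:R)%R.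
Proof.
move=> N8 n0; rewrite le_B_div6; have P0 := primorial_gt0 N.
rewrite ltr_frac ?primorial_gt0 // => lo hi.
have P9 := primorial9.
have [t3 t4 t5 [t6 t7 t8 _]] := total_small.
have [_ r3 r4 r5 r8] := base_covered.
have [_ P _] := @level_primes23 N N8.
(* 3431 is the least numerator over P_6 that is at least B_6 P_6 / 6, and 323 = 17 * 19; the lower
   ends for seven and eight primes are larger. *)
have up8 K : 323 * 3431 <= Z.of_nat n * K <= 4849845 -> low8 (Z.of_nat n * K) ->
    Z.of_nat (primorial 9) = (23 * K) * Z.of_nat (primorial N) ->
    rep 9 (n%:R / (primorial N)%:R)%R.
  move=> nK lK PE; apply: repZ_scale PE.
  rewrite (_ : Z.of_nat n * (23 * K) = 23 * (Z.of_nat n * K)); last by lia.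
  by apply: r8 => //; lia.
(* For N <= 2 no positive fraction lies below 12 / 83. The cases 3, 4, 5 were searched individually;
   6, 7, 8 are rescaled to the denominator P_8. *)
move: N N8 P lo hi up8 P0 => [|[|[|[|[|[|[|[|[|//]]]]]]]]] _ /= P lo hi up8 P0; try lia.
- apply: (repZ_scale (K := 7436429)); last by lia.
  by apply: r3; lia.
- apply: (repZ_scale (K := 1062347)); last by lia.
  by apply: r4; lia.
- apply: (repZ_scale (K := 96577)); last by lia.
  by apply: r5; lia.
- apply: (up8 323); [lia | | lia].
  by apply/or3P/Or33; rewrite Z_mod_mult /=; apply/Z.leb_spec0; lia.
- apply: (up8 19); [lia | | lia].
  by apply/or3P/Or32; rewrite Z_mod_mult /=; apply/Z.leb_spec0; lia.
apply: (up8 1); [lia | | lia].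
by apply/or3P/Or31; apply/Z.leb_spec0; lia.
Qed.

Local Close Scope Z_scope.

(** * Residue sums for primes up to 1300 *)

Local Open Scope Z_scope.

(** Extended Euclidean algorithm with bounded fuel. Its result is not proved correct but verified by
    [inverses_ok]. *)
Fixpoint inverse_loop (fuel : nat) (a b u v : Z) : Z :=
  if fuel is n.+1 then
    if b =? 0 then u else inverse_loop n b (a mod b) v (u - a / b * v)
  else 0.

Definition inverse_mod (p q : nat) : nat :=
  Z.to_nat (inverse_loop 20 (Z.of_nat q) (Z.of_nat p) 1 0 mod Z.of_nat p).

Definition scale := 1000000.
Definition infinite_cost := 1000000000.

(* The table whose entry r is the least cost of a sublist of qs whose inverses
   sum to r modulo p, the cost of q being an upper bound of scale / q. *)
Definition cost_step (p : nat) (q : nat) (t : seq Z) : seq Z :=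
  let w := scale / Z.of_nat q + 1 in
  [seq Z.min xy.1 (xy.2 + w) | xy <- zip t (rot (p - inverse_mod p q) t)].

Definition cost_table (p : nat) (qs : seq nat) : seq Z :=
  foldr (cost_step p) (0 :: nseq p.-1 infinite_cost) qs.

Definition inverses_ok (p : nat) (qs : seq nat) : bool :=
  all (fun q => (Z.of_nat q * Z.of_nat (inverse_mod p q)) mod Z.of_nat p =? 1) qs.

Definition table_ok (bound : Z) (p : nat) (qs : seq nat) : bool :=
  if (bound <? infinite_cost) && inverses_ok p qs then
    all (fun c => c <=? bound) (cost_table p qs) else false.

(* prev lists the primes below the head of ps, largest first; a is a lower bound
   of scale times the sum of their reciprocals. *)
Fixpoint tables_ok (prev : seq nat) (a : Z) (ps : seq nat) : bool :=
  if ps is p :: ps' then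
    if table_ok (a / 6) p (take 14 prev) then
      tables_ok (p :: prev) (a + scale / Z.of_nat p) ps'
    else false
  else true.

Definition floor_sum (qs : seq nat) : Z := foldr (fun q z => z + scale / Z.of_nat q) 0 qs.

Definition cost_sum (qs : seq nat) : Z := foldr (fun q z => z + (scale / Z.of_nat q + 1)) 0 qs.

Lemma cost_sum_ge0 qs : 0 <= cost_sum qs.
Proof.
elim: qs => // q qs IHqs.
have -> : cost_sum (q :: qs) = cost_sum qs + (scale / Z.of_nat q + 1) by [].
suff : 0 <= scale / Z.of_nat q by lia.
by case: q => [|q]; [rewrite Zdiv_0_r | apply: Z.div_pos; rewrite /scale; lia].
Qed.

Lemma recip_sum_cost qs sc : Z.of_nat sc = scale -> {in qs, forall q, 0 < q}%N ->
  (recip_sum qs * sc%:R <= (Z.to_nat (cost_sum qs))%:R)%R.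
Proof.
move=> scE; elim: qs => [|q qs IHqs] qs0; first by rewrite /recip_sum big_nil mul0r.
rewrite /recip_sum big_cons mulrDl addrC.
have q0 : (0 < q)%N by apply: qs0; exact: mem_head.
have -> : Z.to_nat (cost_sum (q :: qs)) = (Z.to_nat (cost_sum qs) + (sc %/ q).+1)%N.
  have -> : cost_sum (q :: qs) = cost_sum qs + (Z.of_nat (sc %/ q) + 1).
    by rewrite Z_of_divn scE.
  by have := @cost_sum_ge0 qs; move: (sc %/ q)%N => k; lia.
rewrite natrD; apply: lerD; first by apply: IHqs => q' q'I; apply: qs0; rewrite inE q'I orbT.
by rewrite mulrC ler_pdivrMr ?ltr0n // -natrM ler_nat ltnW // ltn_ceil.
Qed.

Lemma inverse_mod_lt p q : (0 < p)%N -> (inverse_mod p q < p)%N.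
Proof.
move=> p0; rewrite /inverse_mod; move: (inverse_loop _ _ _ _ _) => u.
by have := Z.mod_pos_bound u (Z.of_nat p); lia.
Qed.

Lemma inverse_modP p q : prime p ->
  (Z.of_nat q * Z.of_nat (inverse_mod p q)) mod Z.of_nat p =? 1 ->
  (0 < inverse_mod p q)%N /\ (q%:R^-1 = (inverse_mod p q)%:R :> 'F_p)%R.
Proof.
move=> p_pr /Z.eqb_eq; move: (inverse_mod p q) => v qv.
have p0 := prime_gt0 p_pr.
have /(congr1 (fun n : nat => n%:R : 'F_p)%R) :
    (q * v = p * Z.to_nat (Z.of_nat q * Z.of_nat v / Z.of_nat p) + 1)%N.
  have := Z.div_mod (Z.of_nat q * Z.of_nat v) (Z.of_nat p); rewrite qv.
  have := Z.div_pos (Z.of_nat q * Z.of_nat v) (Z.of_nat p).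
  move: (Z.of_nat q * Z.of_nat v / Z.of_nat p) => k; nia.
rewrite natrD [in RHS]natrM pchar_Fp_0 // mul0r add0r natrM => e.
have q0 : (q%:R != 0 :> 'F_p)%R.
  by apply/eqP=> q0; move/eqP: e; rewrite q0 mul0r eq_sym oner_eq0.
split; last by rewrite -[LHS]mulr1 -[X in (_ * X)%R]e mulKf.
by case: v qv e => // _ /eqP; rewrite mulr0 eq_sym oner_eq0.
Qed.

Lemma size_cost_table p qs : (0 < p)%N -> size (cost_table p qs) = p.
Proof.
move=> p0; elim: qs => [|q qs IHqs] /=; first by rewrite size_nseq prednK.
by rewrite size_map size_zip size_rot IHqs minnn.
Qed.

Lemma nth_rot (T : Type) (x : T) n s i : (n <= size s)%N -> (i < size s)%N ->
  nth x (rot n s) i = nth x s (if (i + n < size s)%N then i + n else i + n - size s)%N.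
Proof.
move=> ns i_s; rewrite /rot nth_cat size_drop; have [lt|ge] := ltnP i (size s - n).
  by rewrite nth_drop addnC ifT //; lia.
by rewrite nth_take; [rewrite ifF; [congr nth; lia | apply/negbTE; lia] | lia].
Qed.

(** Knapsack recursion: a cheapest sum for [r] either omits [q] or adds [q] to a sum for r - 1/q.
    Entries below [infinite_cost] are attained by actual sublists. *)
Lemma cost_tableP p qs r : prime p -> inverses_ok p qs -> (r < p)%N ->
    nth infinite_cost (cost_table p qs) r < infinite_cost ->
  exists I, [/\ subseq I qs, (\sum_(q <- I) q%:R^-1 = r%:R :> 'F_p)%R &
                cost_sum I <= nth infinite_cost (cost_table p qs) r].
Proof.
move=> p_pr; have p0 := prime_gt0 p_pr.
elim: qs r => [|q qs IHqs] r.
  case: r => [|r] _ rp /=; last by rewrite nth_nseq if_same.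
  by exists [::]; rewrite big_nil.
rewrite /inverses_ok [all _ _]/=.
case/andP=> /(inverse_modP p_pr)[v0 vE] /IHqs{}IHqs rp.
have -> : cost_table p (q :: qs) = cost_step p q (cost_table p qs) by [].
rewrite /cost_step; set t := cost_table p qs in IHqs *.
have st : size t = p by exact: size_cost_table.
have vp := inverse_mod_lt q p0; move: (inverse_mod p q) v0 vE vp => v v0 vE vp.
set w := scale / _ + 1.
have w0 : 0 <= w.
  rewrite /w; have := Z_div_pos scale (Z.of_nat q); rewrite /scale.
  by case: q {vE w} => [|q]; rewrite ?Zdiv_0_r; lia.
rewrite (nth_map (infinite_cost, infinite_cost)) ?size_zip ?size_rot ?st ?minnn //.
rewrite nth_zip ?size_rot //= nth_rot ?st ?leq_subr //.
(* The rotation reads the table at [r'], the residue r - v modulo [p]. *)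
set r' := (if _ then _ else _)%N.
have [r'p r'E] : (r' < p)%N /\ ((r' + v)%N%:R = r%:R :> 'F_p)%R.
  rewrite /r'; case: ifP => h; first last.
    by split; [lia | congr (_%:R)%R; lia].
  split=> //; have -> : (r + (p - v) + v = r + p)%N by lia.
  by rewrite natrD pchar_Fp_0 // addr0.
have [le|lt] := Z.min_spec (nth infinite_cost t r) (nth infinite_cost t r' + w).
  case: le => _ -> /(IHqs r rp)[I [Iqs IE Ic]]; exists I; split=> //.
  exact: subseq_trans Iqs (subseq_cons _ _).
case: lt => _ -> c_lt; have [|I [Iqs IE Ic]] := IHqs r' r'p; first lia.
have costE : cost_sum (q :: I) = cost_sum I + w by [].
exists (q :: I); split; [by rewrite /= eqxx | | by rewrite costE; lia].
by rewrite big_cons IE vE -natrD addnC.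
Qed.

Lemma table_covers N bound p qs sc : Z.of_nat sc = scale -> p = nth_prime N.+1 ->
    {subset qs <= first_primes N} -> uniq qs ->
    table_ok bound p qs -> covers N ((Z.to_nat bound)%:R / sc%:R)%R.
Proof.
move=> scE pE qsN uqs; rewrite /table_ok pE.
case: ifP => // /andP[/Z.ltb_spec0 b_inf ok] /allP tab r.
have p_pr : prime (nth_prime N.+1) by apply: prime_nth_prime.
have rp : (r < nth_prime N.+1)%N by rewrite -{2}(Fp_cast p_pr).
have c_le : nth infinite_cost (cost_table (nth_prime N.+1) qs) r <= bound.
  by apply/Z.leb_spec0/tab/mem_nth; rewrite size_cost_table // prime_gt0.
have [|I [Iqs IE Ic]] := cost_tableP p_pr ok rp; first lia.
exists I; split; first exact: subseq_uniq Iqs uqs.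
- by move=> q /(mem_subseq Iqs)/qsN.
- have sc0 : (0 < sc%:R :> rat)%R by rewrite ltr0n; move: scE; rewrite /scale; lia.
  rewrite ler_pdivlMr //; apply: le_trans (_ : (Z.to_nat (cost_sum I))%:R <= _)%R; last first.
    by rewrite ler_nat; lia.
  by apply: (recip_sum_cost scE) => q /(mem_subseq Iqs)/qsN/first_primes_gt0.
by rewrite IE natr_Zp.
Qed.

Lemma floor_sum_le qs sc : Z.of_nat sc = scale -> {in qs, forall q, 0 < q}%N ->
  0 <= floor_sum qs /\ ((Z.to_nat (floor_sum qs))%:R <= recip_sum qs * sc%:R)%R.
Proof.
move=> scE; elim: qs => [|q qs IHqs] qs0; first by rewrite /= mulr_ge0 ?recip_sum_ge0.
have [|s0 IH] := IHqs; first by move=> q' q'I; apply: qs0; rewrite inE q'I orbT.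
have q0 : (0 < q)%N by apply: qs0; exact: mem_head.
have e : floor_sum (q :: qs) = floor_sum qs + Z.of_nat (sc %/ q) by rewrite /= -scE -Z_of_divn.
rewrite e; split; first by move: (sc %/ q)%N => k; lia.
have -> : Z.to_nat (floor_sum qs + Z.of_nat (sc %/ q)) = (Z.to_nat (floor_sum qs) + sc %/ q)%N.
  by move: (sc %/ q)%N => k; lia.
rewrite natrD /recip_sum big_cons mulrDl addrC; apply: lerD => //.
by rewrite mulrC ler_pdivlMr ?ltr0n // -natrM ler_nat leq_trunc_div.
Qed.

Lemma floor_sum_rcons qs q : floor_sum (rcons qs q) = floor_sum qs + scale / Z.of_nat q.
Proof. by elim: qs => //= q' qs ->; lia. Qed.

(** Each table uses at most the 14 largest smaller primes, which have the smallest reciprocals.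
    Costs are rounded up and the bound A / 6 down, so the integer comparison is safe. *)
Lemma tables_okP N ps sc : Z.of_nat sc = scale ->
    first_primes (N + size ps) = first_primes N ++ ps ->
    tables_ok (rev (first_primes N)) (floor_sum (first_primes N)) ps ->
  forall M, (N <= M < N + size ps)%N -> covers M (recip_sum (first_primes M) / 6%:R)%R.
Proof.
move=> scE; elim: ps N => [|p ps IHps] N; first by rewrite addn0 => _ _ M; lia.
rewrite /= addnS -addSn => fE; case: ifP => // tab rest M /andP[NM Mps].
have lastE : first_primes N.+1 = first_primes N ++ [:: p].
  have := congr1 (take N.+1) fE; rewrite -cat_rcons take_size_cat ?size_rcons ?size_first_primes //.
  by rewrite cats1 => <-; rewrite /first_primes -map_take take_iota; congr map; congr iota; lia.
have pE : p = nth_prime N.+1.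
  by move: lastE; rewrite first_primesS -cats1 => /(congr1 (last 0%N)); rewrite !last_cat.
have [MN|MN] := eqVneq M N; last first.
  apply: (IHps N.+1) => //; last by lia.
  - by rewrite lastE -catA.
  by rewrite lastE cats1 rev_rcons floor_sum_rcons.
rewrite {M NM Mps}MN.
have fp0 : {in first_primes N, forall q, 0 < q}%N by exact: first_primes_gt0.
have [a0 aE] := floor_sum_le scE fp0; set a := floor_sum _ in a0 aE tab rest.
have sub : {subset take 14 (rev (first_primes N)) <= first_primes N}.
  by move=> q /mem_take; rewrite mem_rev.
have uq : uniq (take 14 (rev (first_primes N))) by rewrite take_uniq // rev_uniq first_primes_uniq.
have sc0 : (0 < sc%:R :> rat)%R by rewrite ltr0n; move: scE; rewrite /scale; lia.
move=> r; have [I [uI IN Ic IE]] := table_covers scE pE sub uq tab r.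
exists I; split=> //; apply: le_trans Ic _.
rewrite ler_pdivrMr // mulrAC ler_pdivlMr ?ltr0n //; apply: le_trans aE.
by rewrite -natrM ler_nat; have := Z.mul_div_le a 6; lia.
Qed.

Lemma covers_mono N C C' : (C <= C')%R -> covers N C -> covers N C'.
Proof. by move=> CC' cov r; have [I [? ? /le_trans/(_ CC') ? ?]] := cov r; exists I. Qed.

(** Keeping this number abstract avoids a unary numeral of size one million. *)
Lemma scale_nat : exists sc, Z.of_nat sc = scale.
Proof. by exists (Z.to_nat scale); rewrite Z2Nat.id. Qed.

Lemma scaled_le (sc a b : nat) (c : Z) : Z.of_nat sc = scale -> (0 < b)%N ->
  c * Z.of_nat b <= Z.of_nat a * scale -> ((Z.to_nat c)%:R / sc%:R <= a%:R / b%:R :> rat)%R.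
Proof.
move=> scE b0 cb; have sc0 : (0 < sc)%N by move: scE; rewrite /scale; lia.
by rewrite ler_frac //; move: cb; rewrite -scE; nia.
Qed.

Lemma covers_9 : covers 9 (29%:R / 70%:R).
Proof.
have [sc scE] := scale_nat.
have tab : table_ok 414200 29 (rev primes23) by vm_compute.
have fE : first_primes 9 = primes23 by exact: (first_primes_primes_le 23).
apply: covers_mono (table_covers (qs := rev primes23) scE _ _ _ tab); last 3 first.
- by rewrite (@nth_prime_nth _ 29).
- by move=> q; rewrite mem_rev fE.
- by [].
by apply: (scaled_le scE); rewrite /scale.
Qed.

Definition primes1300 := primes_le 1300.

Lemma first_primes_1300 : first_primes (size primes1300) = primes1300.
Proof. exact: first_primes_primes_le. Qed.

Lemma size_primes1300 : size primes1300 = 211%N.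
Proof. by vm_compute. Qed.

Lemma tables1300 :
  tables_ok (rev (take 10 primes1300)) (floor_sum (take 10 primes1300)) (drop 10 primes1300).
Proof. by vm_compute. Qed.

Lemma covers_tables L n N : first_primes (size L) = L ->
    tables_ok (rev (take n L)) (floor_sum (take n L)) (drop n L) ->
  (n <= N < size L)%N -> covers N (recip_sum (first_primes N) / 6%:R)%R.
Proof.
move=> LE tab /andP[nN NL]; have [sc scE] := scale_nat.
have nL : (n <= size L)%N by apply: leq_trans nN (ltnW NL).
have fE : first_primes n = take n L by rewrite -LE /first_primes -map_take take_iota (minn_idPl nL).
have sE : (n + size (drop n L) = size L)%N by rewrite size_drop subnKC.
apply: (tables_okP scE (N := n) (ps := drop n L)); rewrite ?sE ?nN // fE //.
by rewrite cat_take_drop.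
Qed.

Lemma covers_small N : (10 <= N < 211)%N -> covers N (recip_sum (first_primes N) / 6%:R)%R.
Proof. by rewrite -size_primes1300 => h; exact: covers_tables first_primes_1300 tables1300 h. Qed.

Lemma floor_sum_ge L (a b : nat) : {in L, forall q, 0 < q}%N -> (0 < b)%N ->
  Z.of_nat a * scale <=? floor_sum L * Z.of_nat b -> (a%:R / b%:R <= recip_sum L :> rat)%R.
Proof.
move=> L0 b0 /Z.leb_spec0 ab; have [sc scE] := scale_nat.
have sc0 : (0 < sc)%N by move: scE; rewrite /scale; lia.
have [_] := floor_sum_le scE L0; move: (floor_sum L) ab => f ab.
rewrite -ler_pdivrMr ?ltr0n //; apply: le_trans; rewrite ler_frac //.
by move: ab; rewrite -scE; nia.
Qed.

Lemma recip_sum_211 : (11%:R / 5%:R <= recip_sum (first_primes 211))%R.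
Proof.
apply: floor_sum_ge => //; first exact: first_primes_gt0.
by rewrite -size_primes1300 first_primes_1300; vm_compute.
Qed.

Local Close Scope Z_scope.

(** * Residue sums for primes beyond 1300 *)

Lemma primes_le_sub_first N x : x < nth_prime N.+1 -> {subset primes_le x <= first_primes N}.
Proof.
move=> xp q; rewrite mem_primes_le mem_first_primes => /andP[q_pr qx]; rewrite q_pr /=.
rewrite leqNgt; apply/negP=> Nq; have [_ _ /(_ q Nq q_pr)] := next_primeP (nth_prime N).
by rewrite -nth_primeS leqNgt (leq_ltn_trans qx).
Qed.

Lemma covers_odd_primes N Q k j C : uniq Q -> {subset Q <= first_primes N} ->
    all odd Q -> size Q = k.*2 -> k <= 2 ^ j -> 4 * nth_prime N.+1 <= (k - j.*2) ^ 2 ->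
    2 < nth_prime N.+1 -> (recip_sum Q <= C)%R -> covers N C.
Proof.
move=> uQ QN /allP oQ sQ kj kp p2 QC r.
have p_pr : prime (nth_prime N.+1) by apply: prime_nth_prime.
have podd : odd (nth_prime N.+1) by case: (even_prime p_pr) p2 => // ->.
have [q qQ|I IQ IE] := odd_inverse_sums_cover r p_pr podd uQ _ sQ kj kp.
  rewrite oQ // andTb; have := QN q qQ; rewrite mem_first_primes => /andP[_ qN].
  apply: leq_ltn_trans qN _.
  by rewrite nth_primeS; case: (next_primeP (nth_prime N)).
exists I; split=> //; first exact: subseq_uniq IQ uQ.
  by move=> q /(mem_subseq IQ)/QN.
by apply: le_trans QC; apply: ler_recip_sum_uniq; [exact: subseq_uniq IQ uQ | exact: mem_subseq].
Qed.

(* The primes up to x, without the first d, serve all primes p with x < p <= m. *)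
Definition checkpoint (x d k j m : nat) : bool :=
  let Q := drop d (primes_le x) in
  [&& size Q == k.*2, all odd Q, Z.leb (Z.mul (cost_sum Q) 30) (Z.mul 11 scale), k <= 2 ^ j &
      Z.leb (Z.mul 4 (Z.of_nat m)) (Z.pow (Z.of_nat (k - j.*2)) 2)].

(* 11 / 30 is a sixth of 11 / 5, a lower bound of the reciprocal sum of the first 211
   primes. *)
Lemma checkpointP x d k j m N : checkpoint x d k j m ->
  2 <= x < nth_prime N.+1 -> nth_prime N.+1 <= m -> covers N (11%:R / 30%:R)%R.
Proof.
case/and5P=> /eqP sQ oQ /Z.leb_spec0 costQ kj /Z.leb_spec0 km /andP[x2 xp] pm.
have [sc scE] := scale_nat.
have QN : {subset drop d (primes_le x) <= first_primes N}.
  by move=> q /mem_drop; apply: primes_le_sub_first.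
apply: (covers_odd_primes _ QN oQ sQ kj); last 2 first.
- exact: leq_ltn_trans xp.
- have Q0 : {in drop d (primes_le x), forall q, 0 < q} by move=> q /QN/first_primes_gt0.
  have := recip_sum_cost scE Q0; have := @cost_sum_ge0 (drop d (primes_le x)).
  move: costQ; move: (cost_sum _) => c costQ c0.
  have sc0 : (0 < sc%:R :> rat)%R by rewrite ltr0n; move: scE; rewrite /scale; lia.
  rewrite -(ler_pdivlMr _ _ sc0) => /le_trans; apply; apply: (scaled_le scE) => //.
- by rewrite drop_uniq // primes_le_uniq.
rewrite -mulnn; move: km; rewrite Z.pow_2_r; move: (k - j.*2) => a; nia.
Qed.

(** The first 2 k primes above [y] are used; their reciprocals add up to at most 2 k / y, which 60 k
    <= 11 y bounds by 11 / 30. *)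
Lemma covers_count N x y k j : x < nth_prime N.+1 -> 2 <= y <= x ->
    k.*2 + size (primes_le y) <= size (primes_le x) -> 60 * k <= 11 * y ->
    k <= 2 ^ j -> 4 * nth_prime N.+1 <= (k - j.*2) ^ 2 -> covers N (11%:R / 30%:R)%R.
Proof.
move=> xp /andP[y2 yx] count ky kj kp.
pose Q := take k.*2 [seq q <- iota y.+1 (x - y) | prime q].
have inQ q : q \in Q -> [/\ prime q, y < q & q <= x].
  by move/mem_take; rewrite mem_filter mem_iota addSn subnKC // ltnS => /and3P[].
have sQ : size Q = k.*2.
  rewrite size_takel //; move: count; rewrite (primes_le_cat yx) size_cat.
  by rewrite addnC leq_add2l.
apply: (covers_odd_primes (Q := Q) _ _ _ sQ kj kp).
- by rewrite take_uniq // filter_uniq // iota_uniq.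
- move=> q /inQ[q_pr _ qx]; apply: (primes_le_sub_first xp).
  by rewrite mem_primes_le q_pr qx.
- apply/allP=> q /inQ[q_pr yq _]; case: (even_prime q_pr) => // q2.
  by move: yq y2; rewrite q2; lia.
- by apply: leq_ltn_trans xp; exact: leq_trans yx.
have y0 : 0 < y by exact: ltnW.
apply: le_trans (recip_sum_le y0 _) _; first by move=> q /inQ[_ /ltnW].
by rewrite sQ ler_frac // -muln2; lia.
Qed.

Lemma size_primes_le_half y : 0 < y -> size (primes_le y) <= y./2.+1.
Proof.
move=> y0; have : {subset primes_le y <= 2 :: [seq i.*2.+1 | i <- iota 1 y./2]}.
  move=> q; rewrite mem_primes_le inE => /andP[q_pr qy]; case: (even_prime q_pr) => [->//|oq].
  apply/orP; right; apply/mapP; exists q./2; last by rewrite -{1}(odd_double_half q) oq.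
  rewrite mem_iota; have := prime_gt1 q_pr; have := odd_double_half q; rewrite oq; lia.
move/(uniq_leq_size (primes_le_uniq y)); rewrite /= size_map size_iota //.
Qed.

Lemma covers_dyadic N J y k j : 0 < J -> 2 ^ J < nth_prime N.+1 <= 2 ^ J.+1 ->
    2 <= y <= 2 ^ J -> J * (k.*2 + size (primes_le y)) < 2 ^ J ->
    60 * k <= 11 * y -> k <= 2 ^ j -> 4 * 2 ^ J.+1 <= (k - j.*2) ^ 2 ->
  covers N (11%:R / 30%:R)%R.
Proof.
move=> J0 /andP[lo hi] y_r count ky kj kJ.
apply: (covers_count lo y_r _ ky kj); last by apply: leq_trans kJ; rewrite leq_mul2l.
by have := leq_trans count (chebyshev J0); rewrite ltn_mul2l ltnS => /andP[].
Qed.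

(** The prime count required by [covers_dyadic] for J = 2 h - 1 and y = 6 k, with pi(6 k) <= 3 k +
    1. The main term on the left is 40 h H; in [count_even], where J = 2 h - 2, it is 80 h H. *)
Lemma count_odd h H (k := 2 * H + h.+2.*2) : 9 <= h -> 56 * h <= H ->
  2 * (h.*2.-1 * (k.*2 + (3 * k).+1)) < H * H.
Proof.
rewrite {}/k => h9 Hh; have h1 : h * (56 * h) <= h * H by rewrite leq_mul2l Hh orbT.
have h2 : 56 * h * H <= H * H by rewrite leq_mul2r Hh orbT.
have -> : h.*2.-1 = 2 * h - 1 by lia.
by nia.
Qed.

Lemma count_even h H (k := 2 * H + h.+2.*2) : 10 <= h -> 102 * h <= H ->
  4 * (h.*2.-2 * (k.*2 + (3 * k).+1)) < H * H.
Proof.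
rewrite {}/k => h9 Hh; have h1 : h * (102 * h) <= h * H by rewrite leq_mul2l Hh orbT.
have h2 : 102 * h * H <= H * H by rewrite leq_mul2r Hh orbT.
have -> : h.*2.-2 = 2 * h - 2 by lia.
by nia.
Qed.

Lemma covers_huge N J : 17 <= J -> 2 ^ J < nth_prime N.+1 <= 2 ^ J.+1 ->
  covers N (11%:R / 30%:R)%R.
Proof.
(* 2 ^ h is at least the square root of p, and k - 2 j = 2 * 2 ^ h. *)
move=> J17 p_r; pose h := J.+2./2; pose j := h.+2; pose H := 2 ^ h.
pose k := 2 * H + j.*2.
have h9 : 9 <= h by rewrite /h; lia.
have exp_ge c m : m <= h -> c * m <= 2 ^ m -> 0 < m -> c * h <= H.
  move=> mh cm m0; rewrite /H -(subnKC mh); elim: (h - m) => [|n IHn]; first by rewrite addn0.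
  by rewrite addnS expnS; nia.
have H56 : 56 * h <= H by exact: (exp_ge 56 9).
have count : J * (k.*2 + (3 * k).+1) < 2 ^ J.
  have [J_odd|J_even] : J.+1 = h.*2 \/ J.+2 = h.*2 by rewrite /h; lia.
    have e : 2 * 2 ^ J = H * H by rewrite -expnS J_odd -addnn expnD.
    have J2 : J = h.*2.-1 by lia.
    suff : 2 * (J * (k.*2 + (3 * k).+1)) < 2 * 2 ^ J by rewrite ltn_mul2l.
    by rewrite e J2; apply: count_odd.
  have h10 : 10 <= h by lia.
  have H102 : 102 * h <= H by exact: (exp_ge 102 10).
  have e : 4 * 2 ^ J = H * H.
    by rewrite -[4]/(2 ^ 2) -expnD add2n J_even -addnn expnD.
  have J2 : J = h.*2.-2 by lia.
  suff : 4 * (J * (k.*2 + (3 * k).+1)) < 4 * 2 ^ J by rewrite ltn_mul2l.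
  by rewrite e J2; apply: count_even.
have k0 : 0 < k by rewrite /k /j; lia.
(* y = 6 k satisfies 60 k <= 11 y with room to spare and keeps pi(y) within the estimate 3 k + 1. *)
apply: (@covers_dyadic N J (6 * k) k j) => //; first by lia.
- apply/andP; split; first lia.
  by apply: leq_trans (ltnW count); nia.
- apply: leq_ltn_trans count; rewrite leq_mul2l leq_add2l.
  have k6 : 0 < 6 * k by lia.
  by have := size_primes_le_half k6; lia.
- lia.
- by rewrite /k /j 2!expnS -/H; lia.
have -> : k - j.*2 = 2 * H by rewrite /k addnK.
rewrite expnMn leq_mul2l -expnM muln2 leq_exp2l //; apply/orP; right; rewrite /h; lia.
Qed.

(** For the chosen j, k is least with 4 * 2^(J+1) <= (k - 2j)^2, and y is least with 60 k <= 11 y.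
    Only for the largest block does the trivial bound on pi(y) suffice here. *)
Lemma covers_16 N : 2 ^ 14 < nth_prime N.+1 <= 2 ^ 17 -> covers N (11%:R / 30%:R)%R.
Proof.
move=> /andP[lo hi].
have [p1|p1] := leqP (nth_prime N.+1) (2 ^ 15).
  have p_r : 2 ^ 14 < nth_prime N.+1 <= 2 ^ 15 by rewrite lo p1.
  have s : size (primes_le 2079) <= 320 by vm_compute.
  by apply: (@covers_dyadic N 14 2079 381 9 isT p_r); clear -s; lia.
have [p2|p2] := leqP (nth_prime N.+1) (2 ^ 16).
  have p_r : 2 ^ 15 < nth_prime N.+1 <= 2 ^ 16 by rewrite p1 p2.
  have s : size (primes_le 2902) <= 425 by vm_compute.
  by apply: (@covers_dyadic N 15 2902 532 10 isT p_r); clear -s; lia.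
have p_r : 2 ^ 16 < nth_prime N.+1 <= 2 ^ 17 by rewrite p2 hi.
have s := @size_primes_le_half 4064 isT.
by apply: (@covers_dyadic N 16 4064 745 10 isT p_r); clear -s; lia.
Qed.

(** The ranges from [x] to [m] together contain all primes between 1300 and 2^14. Except in the
    fifth, [m] is the integer part of (k - 2j)^2 / 4. *)
Lemma checkpoints : [/\ checkpoint 1300 33 89 7 1406, checkpoint 1406 34 94 7 1600,
  checkpoint 1600 37 107 7 2162 & checkpoint 2162 44 141 8 3906 /\
  checkpoint 3906 61 239 8 4900 /\ checkpoint 4600 74 274 9 (2 ^ 14)].
Proof. by split; [ | | | split; [ | split]]; vm_compute. Qed.

Lemma nth_prime_gt1300 N : 211 <= N -> 1300 < nth_prime N.+1.
Proof.
move=> N_ge; rewrite ltnNge; apply/negP=> p1300.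
have p_pr : prime (nth_prime N.+1) by apply: prime_nth_prime.
have : nth_prime N.+1 \in first_primes N.
  have : nth_prime N.+1 \in first_primes 211.
    by rewrite -size_primes1300 first_primes_1300 mem_primes_le p_pr.
  case/mapP=> i; rewrite mem_iota => i_r ->; apply: map_f; rewrite mem_iota; lia.
by rewrite (negPf (nth_primeS_notin N)).
Qed.

Lemma covers_large N : 211 <= N -> covers N (11%:R / 30%:R)%R.
Proof.
move=> /nth_prime_gt1300; have [c1 c2 c3 [c4 [c5 c6]]] := checkpoints.
move pE: (nth_prime N.+1) => p p1300.
have [p1|p1] := leqP p 1406; first by apply: (checkpointP c1); rewrite pE.
have [p2|p2] := leqP p 1600; first by apply: (checkpointP c2); rewrite pE.
have [p3|p3] := leqP p 2162; first by apply: (checkpointP c3); rewrite pE.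
have [p4|p4] := leqP p 3906; first by apply: (checkpointP c4); rewrite pE.
have [p5|p5] := leqP p 4900; first by apply: (checkpointP c5); rewrite pE.
have [p6|p6] := leqP p (2 ^ 14).
  by apply: (checkpointP c6); rewrite pE; clear -p5 p6; lia.
clear c1 c2 c3 c4 c5 c6.
have [p7|p7] := leqP p (2 ^ 17); first by apply: covers_16; rewrite pE p6 p7.
(* The logarithm of p - 1 gives 2^J < p <= 2^(J+1), strict at the lower end. *)
pose J := trunc_log 2 p.-1.
have p0 : 0 < p.-1 by lia.
have lo := trunc_logP (isT : 1 < 2) p0; have hi := trunc_log_ltn p.-1 (isT : 1 < 2).
apply: (@covers_huge N J); first by apply: trunc_log_max => //; lia.
by rewrite pE /J; lia.
Qed.

Local Open Scope ring_scope.

(** * Conclusion *)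

Lemma complete_10 : complete 10 (B 10 / 6%:R).
Proof.
have /andP[B9lo B9hi] := B9_bounds.
have p29 : nth_prime 10 = 29%N by rewrite (@nth_prime_nth _ 29).
(* Dividing 29 / 70 by the new prime 29 leaves 1 / 70. The sum 12 / 83 + 1 / 70 is below B_10 / 6 by
   less than 10^-5, hence the sharp lower bound 119 / 132 for B_9. *)
apply: (complete_step _ base_complete covers_9); first by rewrite divr_ge0 ?ler0n.
  rewrite p29 B_rec p29.
  have -> : recip_sum (first_primes 9) = recip_sum primes23.
    by congr recip_sum; exact: (first_primes_primes_le 23).
  rewrite /recip_sum /primes23 !big_cons big_nil; lra.
by have /andP[_ h] := @B_step_le 9 isT; lra.
Qed.

Lemma B_ge N : (9 <= N)%N -> 119%:R / 132%:R < B N.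
Proof.
by move=> N9; have /andP[B9lo _] := B9_bounds; apply: lt_le_trans B9lo (B_mono _ N9).
Qed.

(** The cost A / 6 at the prime p raises B_N / 6 by exactly the increment of B / 6. The complement
    condition needs B_(N+1) <= 5 B_N / 3, which follows from B_N >= 3 / 4 and an increment of at
    most 1 / 2. *)
Lemma complete_B N : (10 <= N)%N -> complete N (B N / 6%:R).
Proof.
move/subnKC <-; elim: (N - 10)%N => [|n IHn]; first by rewrite addn0; exact: complete_10.
rewrite addnS; set M := (10 + n)%N in IHn *; have M10 : (10 <= M)%N by rewrite leq_addr.
have BM := B_ge (ltnW M10); have /andP[_ BM1] := @B_step_le M (ltn_trans (isT : 0 < 9)%N M10).
have cov : covers M (recip_sum (first_primes M) / 6%:R).
  have [M211|M211] := ltnP M 211; first by apply: covers_small; rewrite M10 M211.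
  apply: covers_mono (covers_large M211).
  have sub : {subset first_primes 211 <= first_primes M}.
    by move=> q /mapP[i]; rewrite mem_iota => i_r ->; apply: map_f; rewrite mem_iota; lia.
  by have := ler_recip_sum_uniq (first_primes_uniq 211) sub; have := recip_sum_211; lra.
apply: (complete_step _ IHn cov); [lra | | lra].
by rewrite B_rec mulrDl lerD2l mulrAC.
Qed.

(** For the least L >= M with x <= 5 B_L / 6 the lower bound B_L / 6 <= x holds as well: if L > M,
    then x > 5 B_(L-1) / 6, and B grows by at most 1 / 2 per step. So consecutive ranges overlap. *)
Lemma rep_ge_B N M n : (10 <= M)%N -> (N <= M)%N ->
  B M / 6%:R <= n%:R / (primorial N)%:R -> exists K, rep K (n%:R / (primorial N)%:R).
Proof.
move=> M10 NM; set x := _ / _ => xM.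
have step K : (10 <= K)%N -> (N <= K)%N -> B K / 6%:R <= x <= B K - B K / 6%:R -> rep K x.
  move=> K10 NK xK; have dvd : (primorial N %| primorial K)%N.
    rewrite -(subnKC NK); elim: (K - N)%N => [|k IHk]; first by rewrite addn0.
    by rewrite addnS primorialS dvdn_mull.
  have [c cE] := dvdnP dvd; have := primorial_gt0 K; rewrite cE muln_gt0 => /andP[c0 _].
  have xE : x = (n * c)%:R / (primorial K)%:R.
    rewrite /x cE !natrM; field; rewrite !pnatr_eq0 -!lt0n c0 primorial_gt0 //.
  by move: xK; rewrite xE; apply: complete_B.
have [K MK BK] := B_unbounded (2 * n) M.
have P1 : 1 <= (primorial N)%:R :> rat by rewrite ler1n primorial_gt0.
have xn : x <= n%:R by rewrite ler_pdivrMr ?ltr0n ?primorial_gt0 // ler_peMr ?ler0n.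
have n0 : 0 <= n%:R :> rat by rewrite ler0n.
have exK : exists K, (M <= K)%N && (x <= B K - B K / 6%:R).
  by exists K; rewrite MK /=; move: BK; rewrite natrM; lra.
case: (ex_minnP exK) => L /andP[ML xL] Lmin; exists L.
apply: step; rewrite ?(leq_trans M10) ?(leq_trans NM) // xL andbT.
have [<-//|neLM] := eqVneq M L.
have L0 : (M <= L.-1)%N by lia.
have LE : L = L.-1.+1 by lia.
have : ~~ (x <= B L.-1 - B L.-1 / 6%:R).
  apply/negP=> h; have := Lmin L.-1; rewrite L0 h => /(_ isT); lia.
rewrite -ltNge => xL1; rewrite LE.
have L10 : (9 <= L.-1)%N by lia.
have /andP[_ h] := @B_step_le L.-1 (leq_trans (isT : 0 < 9)%N L10); have := B_ge L10; lra.
Qed.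

(** For N <= 9 three ranges remain: below 12 / 83 the finite search, up to B_9 - 12 / 83 the base
    case, and above it values that exceed B_10 / 6. With N = 9 the first range is empty, since B_9 /
    6 > 12 / 83. *)
Lemma rep_ge_B_lpf N n : (0 < n)%N -> B N / 6%:R <= n%:R / (primorial N)%:R ->
  exists K, rep K (n%:R / (primorial N)%:R).
Proof.
move=> n0 nB; have [N10|N9] := leqP 10 N; first exact: rep_ge_B nB.
have /andP[B9lo B9hi] := B9_bounds.
have [x_lo|x_ge] := ltP (n%:R / (primorial N)%:R : rat) (12%:R / 83%:R).
  have [N8|N8] := leqP N 8; first by exists 9; exact: low_rep.
  have N9' : N = 9%N by lia.
  by move: nB x_lo; rewrite N9'; lra.
have [x_hi|x_gt] := leP (n%:R / (primorial N)%:R : rat) (B 9 - 12%:R / 83%:R).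
  have dvd : (primorial N %| primorial 9)%N.
    rewrite -(subnKC (N9 : (N <= 9)%N)); elim: (9 - N)%N => [|k IHk]; first by rewrite addn0.
    by rewrite addnS primorialS dvdn_mull.
  have [c cE] := dvdnP dvd; have := primorial_gt0 9; rewrite cE muln_gt0 => /andP[c0 _].
  have xE : n%:R / (primorial N)%:R = (n * c)%:R / (primorial 9)%:R :> rat.
    rewrite cE !natrM; field; rewrite !pnatr_eq0 -!lt0n c0 primorial_gt0 //.
  by exists 9; move: x_ge x_hi; rewrite xE => x_ge x_hi; apply: base_complete; rewrite x_ge.
apply: (@rep_ge_B N 10 n isT (ltnW N9)).
by have /andP[_ h] := @B_step_le 9 isT; lra.
Qed.

Lemma squarefree_dvd_primorial b : (0 < b)%N -> squarefree b ->
  (b %| primorial (lpf_index b))%N.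
Proof.
move=> b0 sf; apply/dvdn_partP => // p; rewrite mem_primes => /and3P[p_pr _ pb].
have b1 : (1 < b)%N by apply: leq_trans (prime_gt1 p_pr) (dvdn_leq b0 pb).
have log1 : logn p b = 1%N.
  apply/eqP; rewrite eqn_leq logn_gt0 mem_primes p_pr b0 pb /= andbT leqNgt.
  apply/negP=> log2; have := sf p; rewrite pfactor_dvdn // => /(_ log2) p1.
  by rewrite p1 in p_pr.
rewrite p_part log1 expn1 dvdn_primorial // mem_first_primes p_pr /=.
have [_ ->] := nth_prime_lpf_index b1.
by apply: max_pdiv_max; rewrite mem_primes p_pr b0 pb.
Qed.

(** The index N satisfies p_N = 2, so there is at most one prime up to p_N, and no product of two
    distinct primes arises. *)
Lemma B_lpf_index2 : B (lpf_index 2) = 0.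
Proof.
have [_ p2] := @nth_prime_lpf_index 2 isT; move: (lpf_index 2) p2 => N p2.
have sub : {subset first_primes N <= [:: 2%N]}.
  by move=> q; rewrite mem_first_primes p2 inE => /andP[/prime_gt1 q1 q2]; rewrite eqn_leq q1 q2.
have := uniq_leq_size (first_primes_uniq N) sub; rewrite size_first_primes.
by case: N {p2 sub} => [|[|//]] _; rewrite B_products /recip_sum big_nil.
Qed.

Theorem theorem7p1 :
  (forall a b : nat, (0 < a)%N -> (0 < b)%N -> squarefree b ->
     B (lpf_index b) / 6%:R <= (a%:R / b%:R : rat) ->
     is_sum_of_two_prime_unit_fractions (a%:R / b%:R)) /\
  (forall a : nat, (0 < a)%N ->
     is_sum_of_two_prime_unit_fractions (a%:R / 2%:R)).
Proof.
have main a b : (0 < a)%N -> (0 < b)%N -> squarefree b ->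
    B (lpf_index b) / 6%:R <= (a%:R / b%:R : rat) ->
    is_sum_of_two_prime_unit_fractions (a%:R / b%:R).
  move=> a0 b0 sf; have /dvdnP[c cE] := squarefree_dvd_primorial b0 sf.
  have := primorial_gt0 (lpf_index b); rewrite cE muln_gt0 => /andP[c0 _].
  have -> : a%:R / b%:R = (a * c)%:R / (primorial (lpf_index b))%:R :> rat.
    rewrite cE !natrM; field; rewrite !pnatr_eq0 -!lt0n c0 b0 //.
  by case/rep_ge_B_lpf=> [|K /rep_sum//]; rewrite muln_gt0 a0.
split=> // a a0; apply: main => //; last by rewrite B_lpf_index2 mul0r divr_ge0 ?ler0n.
move=> d d2; have : (d ^ 2 <= 2)%N by apply: dvdn_leq.
by case: d d2 => [|[|[|d]]] //; rewrite -mulnn; lia.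
Qed.
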